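(* Let $1<p<\infty$. Let $(S_i)_{i=1}^\infty$ be functions, each submultiplicative on $[1,\infty)$, such that for every nonempty finite $A\subset\mathbb N$ and every $j\in\mathbb N\setminus A$ one has $\sup_{n\ge1}S_j(n)/\max_{i\in A}S_i(n)=\infty$. Let $w_i(1)=1$ and $w_i(n)=S_i(n)-S_i(n-1)$ for $n\ge2$, and assume $w_i(n)\to0$ for each $i$. For $n\in\mathbb N$ let $X_n(p)=\big(\sum_{i=1}^n\oplus d(w_i,p)\big)_\infty$. Then $(SP_w(X_n(p)),\le)$ is order-isomorphic to $\big(P(n)\cup\{\{1,\dots,n+1\}\}\big)\setminus\{\emptyset\}$ ordered by inclusion, where $P(n)$ is the power set of $\{1,\dots,n\}$.
   Context: A function $S$ on $[1,\infty)$ is submultiplicative on $[1,\infty)$ if: (a) it is piecewise-linear, continuous, strictly increasing and concave; (b) $S(x)=x$ for $1\le x\le2$; (c) $S(xy)\le S(x)S(y)$ for all $x,y\ge1$. A weight sequence is a non-increasing positive sequence $w$ with $w(1)=1$, $w(n)\to0$, $\sum w(n)=\infty$; for $1\le p<\infty$, $d(w,p)$ is the Lorentz sequence space with basis $(e_n)$ and norm $\|\sum a_ne_n\|_{w,p}=(\sum a_n^{*p}w(n))^{1/p}$, $(a_n^* )$ the non-increasing rearrangement of $(|a_n|)$. $(\sum_{i=1}^n\oplus Y_i)_\infty$ is the direct sum with the max norm. A normalized basic sequence $(x_i)$ generates a spreading model $(\tilde x_i)$ if there exist $\varepsilon_n\downarrow0$ such that for all $n$, $(a_i)_{i=1}^n\subseteq[-1,1]$,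 $n\le k_1<\cdots<k_n$: $(1+\varepsilon_n)^{-1}\|\sum a_i\tilde x_i\|\le\|\sum a_ix_{k_i}\|\le(1+\varepsilon_n)\|\sum a_i\tilde x_i\|$. $(v_i)$ dominates $(u_i)$ if $\|\sum a_iu_i\|\le C\|\sum a_iv_i\|$ for some $C$ and all finitely supported $(a_i)$; equivalent means mutual domination. $SP_w(X)$ is the set of equivalence classes of spreading models generated by normalized weakly null sequences in $X$, ordered by $[(\tilde x_i)]\le[(\tilde y_i)]$ iff $(\tilde y_i)$ dominates $(\tilde x_i)$. *)

(* Defs.v *)
From HB Require Import structures.
From mathcomp Require Import all_boot all_order all_algebra.
From mathcomp Require Import all_classical all_reals all_analysis.
Set Implicit Arguments. Unset Strict Implicit. Unset Printing Implicit Defensive.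
Import Order.TTheory GRing.Theory Num.Theory.
Import numFieldNormedType.Exports.
Local Open Scope classical_set_scope.
Local Open Scope ring_scope.

Section Defs.
Variable R : realType.

Definition affine_on (S : R -> R) (a b : R) : Prop :=
  exists c d : R, forall x, a <= x <= b -> S x = c * x + d.

Definition piecewise_linear_on_1oo (S : R -> R) : Prop :=
  forall b : R, 1 <= b ->
    exists t : seq R,
      [/\ head 0 t = 1, last 0 t = b, sorted <%R t &
          forall j : nat, (j.+1 < size t)%N -> affine_on S (nth 0 t j) (nth 0 t j.+1)].

Definition submultiplicative (S : R -> R) : Prop :=
  [/\ piecewise_linear_on_1oo S /\ {within `[1, +oo[, continuous S},
      (forall x y : R, 1 <= x -> x < y -> S x < S y),
      (forall x y t : R, 1 <= x -> 1 <= y -> 0 <= t <= 1 ->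
          t * S x + (1 - t) * S y <= S (t * x + (1 - t) * y)),
      (forall x : R, 1 <= x <= 2 -> S x = x) &
      (forall x y : R, 1 <= x -> 1 <= y -> S (x * y) <= S x * S y)].

(* Sequences are 0-indexed: position k : nat stands for the paper's index k+1. *)

(* w(1) = 1, w(n) = S(n) - S(n-1) for n >= 2 ; here w k = w_paper (k+1) *)
Definition weight_of (S : R -> R) (k : nat) : R :=
  if k is k'.+1 then S k.+1%:R - S k'.+1%:R else 1.

Definition few_above (a : nat -> R) (t : R) (k : nat) : Prop :=
  exists s : seq nat, (size s <= k)%N /\ forall m, t < `|a m| -> m \in s.

(* non-increasing rearrangement: dstar a k = a*_(k+1)
   = inf { t >= 0 | #{m : |a m| > t} < k+1 } *)
Definition dstar (a : nat -> R) (k : nat) : R :=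
  inf [set t : R | 0 <= t /\ few_above a t k].

Definition lorentz_sum (w : nat -> R) (p : R) (a : nat -> R) : \bar R :=
  (\sum_(0 <= k <oo) ((powR (dstar a k) p * w k)%:E))%E.

Definition bounded_seq (a : nat -> R) : Prop := exists M : R, forall m, `|a m| <= M.

Definition in_lorentz (w : nat -> R) (p : R) (a : nat -> R) : Prop :=
  bounded_seq a /\ (lorentz_sum w p a < +oo)%E.

Definition lorentz_norm (w : nat -> R) (p : R) (a : nat -> R) : R :=
  powR (fine (lorentz_sum w p a)) p^-1.

(* an element of the direct sum is x : 'I_n -> nat -> R, x i being its i-th coordinate *)

Definition in_X (n : nat) (w : nat -> nat -> R) (p : R) (x : 'I_n -> nat -> R) : Prop :=
  forall i : 'I_n, in_lorentz (w i) p (x i).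

Definition normX (n : nat) (w : nat -> nat -> R) (p : R) (x : 'I_n -> nat -> R) : R :=
  \big[Num.max/0]_(i < n) lorentz_norm (w i) p (x i).

Definition vadd (n : nat) (x y : 'I_n -> nat -> R) : 'I_n -> nat -> R :=
  fun i m => x i m + y i m.
Definition vscale (n : nat) (c : R) (x : 'I_n -> nat -> R) : 'I_n -> nat -> R :=
  fun i m => c * x i m.
Definition vzero (n : nat) : 'I_n -> nat -> R := fun _ _ => 0.
Definition vcomb (n : nat) (N : nat) (a : nat -> R) (k : nat -> nat)
  (x : nat -> 'I_n -> nat -> R) : 'I_n -> nat -> R :=
  fun j m => \sum_(i < N) a i * x (k i) j m.

Definition bounded_linear_functional (n : nat) (w : nat -> nat -> R) (p : R)
  (f : ('I_n -> nat -> R) -> R) : Prop :=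
  (forall (c : R) x y, in_X w p x -> in_X w p y ->
      f (vadd (vscale c x) y) = c * f x + f y) /\
  exists C : R, forall x, in_X w p x -> `|f x| <= C * normX w p x.

Definition weakly_null (n : nat) (w : nat -> nat -> R) (p : R)
  (x : nat -> 'I_n -> nat -> R) : Prop :=
  forall f, bounded_linear_functional w p f -> (fun k => f (x k)) @ \oo --> (0 : R).

Definition normalized (n : nat) (w : nat -> nat -> R) (p : R)
  (x : nat -> 'I_n -> nat -> R) : Prop :=
  forall k, in_X w p (x k) /\ normX w p (x k) = 1.

Definition in_closed_span (n : nat) (w : nat -> nat -> R) (p : R)
  (x : nat -> 'I_n -> nat -> R) (y : 'I_n -> nat -> R) : Prop :=
  in_X w p y /\
  forall e : R, 0 < e -> exists (N : nat) (a : nat -> R),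
      normX w p (vadd y (vscale (-1) (vcomb N a id x))) < e.

Definition basic_seq (n : nat) (w : nat -> nat -> R) (p : R)
  (x : nat -> 'I_n -> nat -> R) : Prop :=
  forall y, in_closed_span w p x y ->
    exists! a : nat -> R,
      (fun N => normX w p (vadd y (vscale (-1) (vcomb N a id x)))) @ \oo --> (0 : R).

Definition generates_spreading_model (n : nat) (w : nat -> nat -> R) (p : R)
  (x : nat -> 'I_n -> nat -> R) (Y : normedModType R) (xt : nat -> Y) : Prop :=
  exists eps : nat -> R,
    [/\ (forall N, 0 <= eps N), (forall N, eps N.+1 <= eps N),
        eps @ \oo --> (0 : R) &
    forall (N : nat) (a : nat -> R) (k : nat -> nat),
      (forall i, (i < N)%N -> `|a i| <= 1) ->
      (* N <= k_1 < ... < k_N in the paper's 1-based indexing *)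
      (0 < N)%N -> (N <= (k 0%N).+1)%N ->
      (forall i, (i.+1 < N)%N -> (k i < k i.+1)%N) ->
      (1 + eps N)^-1 * `| \sum_(i < N) a i *: xt i |
        <= normX w p (vcomb N a k x)
        <= (1 + eps N) * `| \sum_(i < N) a i *: xt i |].

Definition dominates (Y1 Y2 : normedModType R) (v : nat -> Y1) (u : nat -> Y2) : Prop :=
  exists C : R, forall (N : nat) (a : nat -> R),
    `| \sum_(i < N) a i *: u i | <= C * `| \sum_(i < N) a i *: v i |.

(* xt is (a representative of) an element of SP_w(X) *)
Definition in_SPw (n : nat) (w : nat -> nat -> R) (p : R)
  (Y : normedModType R) (xt : nat -> Y) : Prop :=
  exists x : nat -> 'I_n -> nat -> R,
    [/\ normalized w p x, basic_seq w p x, weakly_null w p x &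
        generates_spreading_model w p x xt].

End Defs.

(* the poset (P(n) u {{1,...,n+1}}) \ {emptyset}; element i : 'I_n.+1 stands for i+1 *)
Definition target_poset (n : nat) : {set {set 'I_n.+1}} :=
  [set A : {set 'I_n.+1} | (A != finset.set0) && ((ord_max \notin A) || (A == finset.setTfor 'I_n.+1))].

(* Main.v *)
Require Import Defs.
From HB Require Import structures.
From mathcomp Require Import all_boot all_order all_algebra.
From mathcomp Require Import all_classical all_reals all_analysis.
From mathcomp Require Import zify ring lra.
Set Implicit Arguments. Unset Strict Implicit. Unset Printing Implicit Defensive.
Import Order.TTheory GRing.Theory Num.Theory.
Import numFieldNormedType.Exports.
Local Open Scope classical_set_scope.
Local Open Scope ring_scope.

(* The Lorentz norm is a supremum over finite lists [s] of distinct indices of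
   [sum_j |a (s_j)|^p w_j]; this turns every estimate below into one about finite sums.

   Let [x_k] be normalized, weakly null in [X_n(p)] and generate a spreading model.  By a
   gliding hump we may take the [x_k] to be disjoint blocks, so that the spreading model is
   dominated by the basis of [l_p].  If in some coordinate the small entries of [x_k] carry
   norm bounded below, choosing each block flat compared with the total length of the
   previous ones shows that the spreading model dominates [l_p].  Otherwise let [A] be the
   set of coordinates whose sup norms do not tend to [0].  Testing at one large entry per
   block shows that the spreading model dominates [d(w_i,p)] for [i] in [A].  Conversely,
   after rounding to dyadic levels a pigeonhole argument makes all blocks have the same level
   counts, and submultiplicativity ([||a (x) u|| <= ||a|| ||u||] in [d(w_i,p)]) bounds the
   spreading model by the maximum of the [d(w_i,p)]-norms over [A].  Hence the class of a
   spreading model is determined by whether it dominates [l_p] and by the set of [i] for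
   which it dominates [d(w_i,p)]; unit vectors and fast growing flat blocks realise all
   admissible values, and the hypothesis on the [S_i] separates them. *)

(** * Sums of entries against non-increasing weights *)

Section RankedSums.
Variable R : realType.
Implicit Types (w c : nat -> R) (s t : seq nat).

(** For a fixed list the sum is linear in the p-th powers of the entries, a property that decreasing
    rearrangement destroys; disjoint pieces and dyadic layers can therefore be treated separately
    inside one list. The price is paid in ranks: a piece placed after others meets smaller weights,
    and lower estimates must control this delay. A spreading model determines, up to constants, the
    norms of combinations of any [N] terms taken far enough out. Each estimate therefore runs its
    own gliding hump for the given [N], with an error of order [1 / (N + 1)] per term, and no block
    subsequence has to serve all [N]. The total error is a multiple of the coefficient norm. The
    obstacle to the upper estimate is that blocks differ in shape, while the tensor inequality wants
    one common shape. Entries above a threshold are boundedly many because the weights have infinite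
    sum, so only finitely many rounded shapes occur. *)

Record weight w : Prop := Weight {
  weight0 : w 0%N = 1;
  weight_ge0 : forall k, 0 <= w k;
  weightS : forall k, w k.+1 <= w k }.

Definition wsum w (N : nat) : R := \sum_(l < N) w l.

(** The position in the list plays the role of the rank, in whatever order the entries come; [q]
    counts the weights already spent on earlier entries. *)
Fixpoint rsum w c (q : nat) s : R :=
  if s is m :: s' then c m * w q + rsum w c q.+1 s' else 0.

Lemma wsum0 w : wsum w 0 = 0. Proof. by rewrite /wsum big_ord0. Qed.

Lemma wsumS w N : wsum w N.+1 = wsum w N + w N.
Proof. by rewrite /wsum big_ord_recr. Qed.

(** Through this weight l_p is a Lorentz space too, and every statement about gauges covers it. *)
Lemma weight_const1 : weight (fun=> 1 : R).
Proof. by split. Qed.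

Section Weighted.
Variable w : nat -> R.
Hypothesis Hw : weight w.

Lemma weight_anti q q' : (q <= q')%N -> w q' <= w q.
Proof.
move=> /subnK <-; elim: (q' - q)%N => // d IH.
by rewrite addSn; apply: le_trans IH; exact: weightS.
Qed.

Lemma weight_le1 q : w q <= 1.
Proof. by rewrite -(weight0 Hw) weight_anti. Qed.

Lemma wsum_ge0 N : 0 <= wsum w N.
Proof. by apply: sumr_ge0 => i _; exact: weight_ge0. Qed.

Lemma wsum_le N N' : (N <= N')%N -> wsum w N <= wsum w N'.
Proof.
move=> /subnK <-; elim: (N' - N)%N => // d IH.
by rewrite addSn wsumS; apply: (le_trans IH); rewrite lerDl weight_ge0.
Qed.

Lemma wsum_le_nat N : wsum w N <= N%:R.
Proof.
elim: N => [|N IH]; first by rewrite wsum0.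
by rewrite wsumS -natr1; apply: lerD IH (weight_le1 _).
Qed.

Lemma rsum_cat c q s t :
  rsum w c q (s ++ t) = rsum w c q s + rsum w c (q + size s) t.
Proof.
elim: s q => [|m s IH] q /=; first by rewrite add0r addn0.
by rewrite IH addrA addnS addSn.
Qed.

Lemma rsum_le c c' q s :
  (forall m, m \in s -> c m <= c' m) -> rsum w c q s <= rsum w c' q s.
Proof.
elim: s q => //= m s IH q H; apply: lerD.
  by apply: ler_wpM2r; [exact: weight_ge0|apply: H; rewrite mem_head].
by apply: IH => l ls; apply: H; rewrite inE ls orbT.
Qed.

Lemma eq_rsum c c' q s :
  (forall m, m \in s -> c m = c' m) -> rsum w c q s = rsum w c' q s.
Proof.
by move=> H; apply/eqP; rewrite eq_le !rsum_le // => m ms; rewrite H.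
Qed.

Lemma rsum_anti c q q' s : (forall m, 0 <= c m) -> (q <= q')%N ->
  rsum w c q' s <= rsum w c q s.
Proof.
move=> c0; elim: s q q' => //= m s IH q q' qq'; apply: lerD; last exact: IH.
by apply: ler_wpM2l => //; exact: weight_anti.
Qed.

(** Removing null entries moves the others to earlier ranks, where the weights are larger. *)
Lemma rsum_filter c (P : pred nat) q s : (forall m, 0 <= c m) ->
  (forall m, m \in s -> ~~ P m -> c m = 0) ->
  rsum w c q s <= rsum w c q (seq.filter P s).
Proof.
move=> c0; elim: s q => //= m s IH q H.
have Hs l : l \in s -> ~~ P l -> c l = 0.
  by move=> ls; apply: H; rewrite inE ls orbT.
case: ifP => Pm /=; first by rewrite lerD2l IH.
rewrite H ?mem_head ?Pm // mul0r add0r.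
by apply: le_trans (IH _ Hs); exact: rsum_anti.
Qed.

Lemma rsum_shift c B q s : (forall m, m \in s -> c m <= B) ->
  rsum w c q s <= rsum w c q.+1 s + B * (w q - w (q + size s)).
Proof.
elim: s q => [|m s IH] q H /=; first by rewrite addn0 subrr mulr0 addr0.
have Hs l : l \in s -> c l <= B by move=> ls; apply: H; rewrite inE ls orbT.
have := IH q.+1 Hs; rewrite addSn addnS => {}IH.
have h1 : c m * (w q - w q.+1) <= B * (w q - w q.+1).
  by apply: ler_wpM2r; [rewrite subr_ge0 weightS|apply: H; rewrite mem_head].
by nra.
Qed.

(** The losses of a one-rank delay telescope, so a delay by [q] ranks costs at most [B * q] whatever
    the length of the list. Flat blocks have a tiny [B], which is why earlier blocks barely harm
    them. *)
Lemma rsum_shiftn c B q s : 0 <= B -> (forall m, m \in s -> c m <= B) ->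
  rsum w c 0 s <= rsum w c q s + B * q%:R.
Proof.
move=> B0 H; elim: q => [|q IH]; first by rewrite mulr0 addr0.
apply: (le_trans IH); rewrite -natr1 mulrDr mulr1 (addrC (B * _)) addrA lerD2r.
apply: (le_trans (rsum_shift q H)); rewrite lerD2l -[leRHS]mulr1.
apply: ler_wpM2l => //.
by have := weight_le1 q; have := weight_ge0 Hw (q + size s); lra.
Qed.

Lemma rsum_map c g q s : rsum w c q (map g s) = rsum w (c \o g) q s.
Proof. by elim: s q => //= m s IH q; rewrite IH. Qed.

Lemma rsumD c c' q s :
  rsum w (fun m => c m + c' m) q s = rsum w c q s + rsum w c' q s.
Proof. by elim: s q => [|m s IH] q /=; rewrite ?addr0 // IH; ring. Qed.

Lemma rsumZ k c q s : rsum w (fun m => k * c m) q s = k * rsum w c q s.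
Proof. by elim: s q => [|m s IH] q /=; rewrite ?mulr0 // IH; ring. Qed.

Lemma rsum_sum (I : Type) (r : seq I) (P : pred I) (F : I -> nat -> R) q s :
  rsum w (fun m => \sum_(i <- r | P i) F i m) q s =
  \sum_(i <- r | P i) rsum w (F i) q s.
Proof.
elim: s q => [|m s IH] q /=; first by rewrite big1.
by rewrite IH mulr_suml -big_split.
Qed.

Lemma rsum_const1 s : rsum w (fun=> 1) 0 s = wsum w (size s).
Proof.
suff H q : rsum w (fun=> 1) q s = wsum w (q + size s) - wsum w q.
  by rewrite H wsum0 subr0 add0n.
elim: s q => [|m s IH] q /=; first by rewrite addn0 subrr.
by rewrite IH addnS addSn !wsumS mul1r; ring.
Qed.

(** The entries satisfying [P] are distinct members of [e], and at best they occupy the first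
    ranks. *)
Lemma rsum_indic (P : pred nat) (e : seq nat) s : uniq s ->
  (forall m, m \in s -> P m -> m \in e) ->
  rsum w (fun m => (P m)%:R) 0 s <= wsum w (size e).
Proof.
move=> us H.
apply: (@le_trans _ _ (rsum w (fun m => (P m)%:R) 0 (seq.filter P s))).
  by apply: rsum_filter => [m|m _ /negbTE->]; rewrite ?ler0n.
rewrite (@eq_rsum _ (fun=> 1)); last by move=> m; rewrite mem_filter => /andP[->].
rewrite rsum_const1; apply: wsum_le; apply: uniq_leq_size.
  exact: filter_uniq.
by move=> m; rewrite mem_filter => /andP[Pm ms]; exact: H.
Qed.

Lemma rsum_move_min c m q s : (forall l, l \in s -> c m <= c l) ->
  c m * w q + rsum w c q.+1 s <= rsum w c q s + c m * w (q + size s).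
Proof.
elim: s q => [|l s IH] q H /=; first by rewrite addn0 addr0 add0r.
have /(IH q.+1) : forall l, l \in s -> c m <= c l.
  by move=> k ks; apply: H; rewrite inE ks orbT.
rewrite addSn addnS => {}IH.
have : c m * (w q - w q.+1) <= c l * (w q - w q.+1).
  by apply: ler_wpM2r; [rewrite subr_ge0 weightS|apply: H; rewrite mem_head].
by nra.
Qed.

(* Moving a smallest entry to the end does not decrease the sum, so the entries
   can be compared with [D] one rank at a time, without sorting. *)
Lemma rsum_le_rearranged c (D : nat -> R) s : uniq s ->
  (forall e, uniq e -> e != [::] ->
     exists2 m, m \in e & (forall l, l \in e -> c m <= c l) /\ c m <= D (size e).-1) ->
  rsum w c 0 s <= \sum_(j < size s) D j * w j.
Proof.
move=> us H; move Es : (size s) => N.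
elim: N s us Es => [|N IH] s us Es.
  by rewrite big_ord0 (size0nil Es).
have [|m ms [mmin mD]] := H s us; first by case: (s) Es.
case/splitPr: ms Es us mmin mD => s1 s2 Es' us mmin mD.
have us12 : uniq (s1 ++ s2).
  by move: us; rewrite -cat1s uniq_catCA cat1s cons_uniq => /andP[].
have s12 : size (s1 ++ s2) = N.
  by move: Es'; rewrite !size_cat /= addnS => -[].
rewrite big_ord_recr /=.
have {}Es' : (size (s1 ++ m :: s2)).-1 = N by rewrite Es'.
apply: (@le_trans _ _ (rsum w c 0 (s1 ++ s2) + c m * w N)); last first.
  by apply: lerD; [exact: IH|apply: ler_wpM2r; [exact: weight_ge0|rewrite -Es']].
rewrite !rsum_cat add0n -addrA lerD2l /= -s12 size_cat.
by apply: rsum_move_min => l ls; apply: mmin; rewrite mem_cat inE ls !orbT.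
Qed.

End Weighted.

End RankedSums.

(** * The Lorentz norm as a supremum over finite lists *)

Section Gauge.
Variable R : realType.
Implicit Types (w a b : nat -> R) (p C : R) (s t : seq nat).

Definition abspow p a : nat -> R := fun m => `|a m| `^ p.

(** A bound of this kind carries membership in the space with it. The norm itself is defined through
    [fine] and would be 0 for an infinite sum. *)
Definition lorentz_le w p a C : Prop :=
  0 <= C /\ forall s, uniq s -> rsum w (abspow p a) 0 s <= C `^ p.

Lemma abspow_ge0 p a m : 0 <= abspow p a m.
Proof. exact: powR_ge0. Qed.

Lemma powR_le_abs p x y : 0 < p -> 0 <= x -> x <= y -> x `^ p <= y `^ p.
Proof.
move=> p0 x0 xy; apply: ge0_ler_powR => //; first exact: ltW.
by rewrite nnegrE (le_trans x0).
Qed.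

Lemma powR_le_inv p x y : 0 < p -> 0 <= x -> 0 <= y -> x `^ p <= y `^ p -> x <= y.
Proof.
move=> p0 x0 y0 xy; rewrite leNgt; apply/negP => yx.
have := gt0_ltr_powR p0 (y0 : y \in Num.nneg) (x0 : x \in Num.nneg) yx.
by rewrite ltNge xy.
Qed.

Lemma powRK p x : 0 < p -> 0 <= x -> (x `^ p^-1) `^ p = x.
Proof. by move=> p0 x0; rewrite -powRrM mulVf ?gt_eqF // powRr1. Qed.

Lemma powRVK p x : 0 < p -> 0 <= x -> (x `^ p) `^ p^-1 = x.
Proof. by move=> p0 x0; rewrite -powRrM mulfV ?gt_eqF // powRr1. Qed.

Section Dstar.
Variable a : nat -> R.
Hypothesis ba : bounded_seq a.

Let D k := [set t : R | 0 <= t /\ few_above a t k].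

Let D_neq0 k : D k !=set0.
Proof.
have [M HM] := ba; exists M; split; first exact: le_trans (HM 0%N).
by exists [::]; split => // m; rewrite ltNge HM.
Qed.

Let D_lb k : has_lbound (D k).
Proof. by exists 0 => t -[]. Qed.

Lemma dstar_ge0 k : 0 <= dstar a k.
Proof. by apply: lb_le_inf; [exact: D_neq0|move=> t []]. Qed.

Lemma dstar_fresh k s u : (size s <= k)%N -> 0 <= u -> u < dstar a k ->
  exists2 m, m \notin s & u < `|a m|.
Proof.
move=> sk u0 ud; apply: contrapT => H.
suff : D k u by move=> /(ge_inf (D_lb k)); rewrite leNgt ud.
split => //; exists s; split => // m um; apply: contrapT => /negP ms.
by apply: H; exists m.
Qed.

Lemma min_le_dstar e m : uniq e -> e != [::] -> m \in e ->
  (forall l, l \in e -> `|a m| <= `|a l|) -> `|a m| <= dstar a (size e).-1.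
Proof.
move=> ue e0 me mmin; apply: lb_le_inf; first exact: D_neq0.
move=> u [u0 [s [ss Hs]]]; rewrite leNgt; apply/negP => um.
have : (size e <= size s)%N.
  by apply: uniq_leq_size => // l le; apply: Hs; apply: lt_le_trans um (mmin _ le).
by move=> h; have := leq_trans h ss; case: (e) e0 => //= x l _; rewrite ltnn.
Qed.

Lemma ex_min (f : nat -> R) (e : seq nat) : e != [::] ->
  exists2 m, m \in e & forall l, l \in e -> f m <= f l.
Proof.
elim: e => // x [|y e] IH _.
  by exists x; rewrite ?mem_head // => l; rewrite inE => /eqP->.
have [m me mmin] := IH isT; have [xm|/ltW mx] := leP (f x) (f m).
  exists x; first by rewrite mem_head.
  by move=> l; rewrite inE => /orP[/eqP->//|/mmin]; exact: le_trans.
exists m; first by rewrite inE me orbT.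
by move=> l; rewrite inE => /orP[/eqP->//|/mmin].
Qed.

(** The infimum defining [dstar] may fail to be a value of [|a|], hence the factor [th < 1]: any
    level strictly below [dstar a N] is exceeded at an index not chosen so far. *)
Lemma dstar_greedy (th : R) N : 0 <= th < 1 ->
  exists s, [/\ uniq s, size s = N &
    forall j, (j < N)%N -> th * dstar a j <= `|a (nth 0%N s j)|].
Proof.
move=> /andP[th0 th1]; elim: N => [|N [s [us ss Hs]]]; first by exists [::].
suff [m ms Hm] : exists2 m, m \notin s & th * dstar a N <= `|a m|.
  exists (rcons s m); split; first by rewrite rcons_uniq ms.
    by rewrite size_rcons ss.
  move=> j; rewrite ltnS leq_eqVlt nth_rcons ss => /orP[/eqP->|jN].
    by rewrite ltnn eqxx.
  by rewrite jN; exact: Hs.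
have [d0|d0] := ltP 0 (dstar a N).
  have [|||m ms Hm] := @dstar_fresh N s (th * dstar a N).
  - by rewrite ss.
  - by rewrite mulr_ge0 ?dstar_ge0.
  - by rewrite gtr_pMl.
  - by exists m => //; exact: ltW.
(* When [dstar a N] vanishes the bound is void, and any new index will do. *)
exists (\max_(i <- s) i).+1; last first.
  by apply: le_trans (normr_ge0 _); rewrite mulr_ge0_le0.
apply/negP => ms; have := @leq_bigmax_seq _ s (fun=> true) id _ ms isT.
by rewrite ltnn.
Qed.

Lemma rsum_nth w (c : nat -> R) s :
  rsum w c 0 s = \sum_(j < size s) c (nth 0%N s j) * w j.
Proof.
suff H q : rsum w c q s = \sum_(j < size s) c (nth 0%N s j) * w (q + j)%N.
  by rewrite H; apply: eq_bigr => j _; rewrite add0n.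
elim: s q => [|m s IH] q /=; first by rewrite big_ord0.
rewrite big_ord_recl /= addn0 IH; congr (_ + _); apply: eq_bigr => j _.
by rewrite /bump /= add1n addSnnS.
Qed.

Lemma rsum_le_dstar w p s : weight w -> 0 < p -> uniq s ->
  rsum w (abspow p a) 0 s <= \sum_(j < size s) dstar a j `^ p * w j.
Proof.
move=> Hw p0 us.
apply: (rsum_le_rearranged Hw (D := fun j => dstar a j `^ p)) => //.
move=> e ue e0; have [m me mmin] := ex_min (fun l => `|a l|) e0.
exists m => //; split => [l le|]; first exact: powR_le_abs (mmin _ le).
by apply: powR_le_abs => //; exact: min_le_dstar.
Qed.

Lemma dstar_sum_le w p M N : weight w -> 0 < p ->
  (forall s, uniq s -> rsum w (abspow p a) 0 s <= M) ->
  \sum_(j < N) dstar a j `^ p * w j <= M.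
Proof.
move=> Hw p0 HM; apply/ler_addgt0Pl => e e0.
set X := \sum_(j < N) _.
have X0 : 0 <= X.
  by apply: sumr_ge0 => j _; rewrite mulr_ge0 ?powR_ge0 // (weight_ge0 Hw).
(* it suffices to bound [c X] by [M] for every [c < 1], here [c = X / (X + e)] *)
have key c : 0 <= c < 1 -> c * X <= M.
  move=> /andP[c0 c1]; have th : 0 <= c `^ p^-1 < 1.
    have := @gt0_ltr_powR _ p^-1; rewrite invr_gt0 => /(_ p0 c 1 c0 ler01 c1).
    by rewrite powR1 powR_ge0.
  have [s [us ss Hs]] := dstar_greedy N th.
  apply: le_trans (HM s us); rewrite rsum_nth ss mulr_sumr.
  apply: ler_sum => j _; rewrite mulrA; apply: ler_wpM2r; first exact: weight_ge0 Hw _.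
  have := Hs j (ltn_ord j); rewrite -{2}(powRK p0 c0) -powRM ?powR_ge0 ?dstar_ge0 //.
  by apply: powR_le_abs => //; rewrite mulr_ge0 ?powR_ge0 ?dstar_ge0.
have Xe : 0 < X + e by rewrite ltr_wpDl.
have M0 : 0 <= M by have := HM [::] isT.
have : X / (X + e) * X <= M.
  apply: key; apply/andP; split; first by rewrite divr_ge0 // ltW.
  by rewrite ltr_pdivrMr // mul1r ltrDl.
rewrite mulrAC ler_pdivrMr // => h.
by nra.
Qed.

(** The bridge from rearrangements to lists. One way, a list is compared with [dstar] rank by rank;
    the other way, greedy lists nearly attain the partial sums. *)
Lemma lorentz_sum_le w p M : weight w -> 0 < p ->
  (lorentz_sum w p a <= M%:E)%E <->
  forall s, uniq s -> rsum w (abspow p a) 0 s <= M.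
Proof.
move=> Hw p0.
have T0 k : (0 <= ((dstar a k `^ p * w k)%:E))%E.
  by rewrite lee_fin mulr_ge0 ?powR_ge0 // (weight_ge0 Hw).
split=> [H s us|H].
  rewrite -lee_fin; apply: le_trans H.
  apply: (@le_trans _ _ (\sum_(0 <= k < size s) ((dstar a k `^ p * w k)%:E))%E).
    by rewrite sumEFin lee_fin big_mkord; exact: rsum_le_dstar.
  by apply: nneseries_lim_ge => k *; exact: T0.
apply: lime_le; first by apply: is_cvg_nneseries => k _ _; exact: T0.
apply: nearW => N; rewrite sumEFin lee_fin big_mkord.
exact: (dstar_sum_le N Hw p0 H).
Qed.

End Dstar.

Lemma lorentz_le_abs w p a C m : weight w -> 0 < p ->
  lorentz_le w p a C -> `|a m| <= C.
Proof.
move=> Hw p0 [C0 /(_ [:: m] isT)] /=.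
rewrite (weight0 Hw) mulr1 addr0; exact: powR_le_inv.
Qed.

Lemma lorentz_sum_ge0 w p a : weight w -> bounded_seq a ->
  (0 <= lorentz_sum w p a)%E.
Proof.
move=> Hw ba; apply: nneseries_ge0 => k _ _.
by rewrite lee_fin mulr_ge0 ?powR_ge0 // (weight_ge0 Hw).
Qed.

Lemma lorentz_norm_ge0 w p a : 0 <= lorentz_norm w p a.
Proof. exact: powR_ge0. Qed.

Lemma lorentz_le_in w p a C : weight w -> 0 < p ->
  lorentz_le w p a C -> in_lorentz w p a.
Proof.
move=> Hw p0 H; have ba : bounded_seq a.
  by exists C => m; exact: lorentz_le_abs H.
split=> //; have [_ /(lorentz_sum_le ba _ Hw p0)] := H.
by move=> /le_lt_trans; apply; rewrite ltry.
Qed.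

Lemma lorentz_le_norm w p a C : weight w -> 0 < p ->
  lorentz_le w p a C -> lorentz_norm w p a <= C.
Proof.
move=> Hw p0 H; have [ba fa] := lorentz_le_in Hw p0 H.
have [C0 /(lorentz_sum_le ba _ Hw p0) le] := H.
have ge := lorentz_sum_ge0 p Hw ba.
rewrite /lorentz_norm -(powRVK p0 C0); apply: powR_le_abs.
- by rewrite invr_gt0.
- exact: fine_ge0.
- by rewrite -lee_fin fineK // ge0_fin_numE.
Qed.

Lemma lorentz_norm_le w p a : weight w -> 0 < p ->
  in_lorentz w p a -> lorentz_le w p a (lorentz_norm w p a).
Proof.
move=> Hw p0 [ba fa]; split; first exact: lorentz_norm_ge0.
have ge := lorentz_sum_ge0 p Hw ba.
apply/(lorentz_sum_le ba _ Hw p0).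
by rewrite /lorentz_norm powRK ?fine_ge0 // fineK // ge0_fin_numE.
Qed.

End Gauge.

(** * Triangle inequality, changes of support, levels and tails *)

Section GaugeTheory.
Variables (R : realType) (p : R).
Hypothesis p1 : 1 <= p.
Implicit Types (w a b c : nat -> R) (C : R) (s t : seq nat).

Let p0 : 0 < p. Proof. exact: lt_le_trans p1. Qed.

(** Convexity of the p-th power at [x / A] and [y / B] with weights [A / (A + B)] and [B / (A + B)].
    The bound is linear in the p-th powers, so it can be summed along any list, and for sums at most
    [A^p] and [B^p] it gives exactly [(A + B)^p]. *)
Lemma minkowski_pointwise (A B x y : R) : 0 < A -> 0 < B -> 0 <= x -> 0 <= y ->
  (x + y) `^ p <= (A + B) `^ p * (A / (A + B)) / A `^ p * x `^ p
                + (A + B) `^ p * (B / (A + B)) / B `^ p * y `^ p.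
Proof.
move=> A0 B0 x0 y0; have AB0 : 0 < A + B by rewrite addr_gt0.
have Ap : A `^ p != 0 by rewrite gt_eqF ?powR_gt0.
have Bp : B `^ p != 0 by rewrite gt_eqF ?powR_gt0.
set u := A / (A + B).
have u0 : 0 <= u by rewrite divr_ge0 // ltW.
have u1 : u <= 1 by rewrite ler_pdivrMr // mul1r lerDl ltW.
have uE : 1 - u = B / (A + B) by rewrite /u; field; rewrite gt_eqF.
have := @convex_powR R p p1 (Itv01 u0 u1) (x / A) (y / B).
rewrite !inE /= !in_itv /= !andbT !divr_ge0 ?(ltW A0) ?(ltW B0) // => /(_ isT isT) h.
rewrite convRE [X in X `^ _ <= _]convRE /= /unstable.onem uE in h.
have -> : x + y = (A + B) * (u * (x / A) + B / (A + B) * (y / B)).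
  by rewrite /u; field; rewrite !gt_eqF.
rewrite [((A + B) * _) `^ p]powRM ?(ltW AB0) //; last first.
  by apply: addr_ge0; apply: mulr_ge0; rewrite ?divr_ge0 ?(ltW A0) ?(ltW B0) ?(ltW AB0).
move: h => /(ler_wpM2l (powR_ge0 (A + B) p)) /le_trans; apply.
have -> : (x / A) `^ p = x `^ p / A `^ p.
  by rewrite -[in LHS]powR_inv1 ?(ltW A0) // powRM ?powR_ge0 // powRAC powR_inv1 ?powR_ge0.
have -> : (y / B) `^ p = y `^ p / B `^ p.
  by rewrite -[in LHS]powR_inv1 ?(ltW B0) // powRM ?powR_ge0 // powRAC powR_inv1 ?powR_ge0.
rewrite le_eqVlt; apply/orP; left; apply/eqP.
by field; rewrite !gt_eqF ?powR_gt0.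
Qed.

Section OneWeight.
Variable w : nat -> R.
Hypothesis Hw : weight w.

Lemma lorentz_leW a C C' : C <= C' -> lorentz_le w p a C -> lorentz_le w p a C'.
Proof.
move=> CC' [C0 H]; split; first exact: le_trans CC'.
by move=> s /H/le_trans; apply; exact: powR_le_abs.
Qed.

(** Rearrangement invariance and monotonicity in one: a list for [a], cut down to its support, is
    carried by [g] to a list of distinct indices for [b]. *)
Lemma lorentz_le_inj (g : nat -> nat) a b C : lorentz_le w p b C ->
  (forall m, a m != 0 -> `|a m| <= `|b (g m)|) ->
  (forall m m', a m != 0 -> a m' != 0 -> g m = g m' -> m = m') ->
  lorentz_le w p a C.
Proof.
move=> [C0 H] le inj; split=> // s us.
pose s' := seq.filter (fun m => a m != 0) s.
apply: (@le_trans _ _ (rsum w (abspow p a) 0 s')).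
  apply: rsum_filter => // [m|m _ /negPn/eqP]; first exact: abspow_ge0.
  by rewrite /abspow => ->; rewrite normr0 powR0 // gt_eqF.
apply: le_trans (H (map g s') _); last first.
  rewrite map_inj_in_uniq ?filter_uniq // => m m'.
  by rewrite !mem_filter => /andP[? _] /andP[? _]; exact: inj.
rewrite rsum_map; apply: rsum_le => // m; rewrite mem_filter => /andP[am _].
by apply: powR_le_abs => //=; exact: le.
Qed.

Lemma lorentz_le_mono a b C : (forall m, `|a m| <= `|b m|) ->
  lorentz_le w p b C -> lorentz_le w p a C.
Proof. by move=> ab H; apply: (lorentz_le_inj (g := id) H). Qed.

Lemma lorentz_le0 C : 0 <= C -> lorentz_le w p (fun=> 0) C.
Proof.
move=> C0; split=> // s _; apply: le_trans (powR_ge0 _ _).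
apply: (@le_trans _ _ (rsum w (fun m => 0 * 0) 0 s)).
  by apply: rsum_le => // m _; rewrite /abspow normr0 powR0 ?mulr0 // gt_eqF.
by rewrite (rsumZ w 0 (fun=> 0)) mul0r.
Qed.

Lemma lorentz_leZ k a C : lorentz_le w p a C ->
  lorentz_le w p (fun m => k * a m) (`|k| * C).
Proof.
move=> [C0 H]; split=> [|s us]; first by rewrite mulr_ge0.
rewrite powRM //; apply: le_trans (ler_wpM2l (powR_ge0 _ _) (H s us)).
rewrite -rsumZ; apply: rsum_le => // m _.
by rewrite /abspow normrM powRM.
Qed.

Lemma lorentz_leD a b A B : lorentz_le w p a A -> lorentz_le w p b B ->
  lorentz_le w p (fun m => a m + b m) (A + B).
Proof.
move=> Ha Hb; have [A0 sa] := Ha; have [B0 sb] := Hb.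
move: A0; rewrite le_eqVlt => /predU1P[A0|A0].
  rewrite -A0 add0r; apply: lorentz_le_mono Hb => m.
  by have := lorentz_le_abs m Hw p0 Ha; rewrite -A0 normr_le0 => /eqP->; rewrite add0r.
move: B0; rewrite le_eqVlt => /predU1P[B0|B0].
  rewrite -B0 addr0; apply: lorentz_le_mono Ha => m.
  by have := lorentz_le_abs m Hw p0 Hb; rewrite -B0 normr_le0 => /eqP->; rewrite addr0.
have AB0 : 0 < A + B by rewrite addr_gt0.
split=> [|s us]; first exact: ltW.
pose k1 := (A + B) `^ p * (A / (A + B)) / A `^ p.
pose k2 := (A + B) `^ p * (B / (A + B)) / B `^ p.
apply: (@le_trans _ _ (rsum w (fun m => k1 * abspow p a m + k2 * abspow p b m) 0 s)).
  apply: rsum_le => // m _; rewrite /abspow.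
  apply: le_trans (minkowski_pointwise A0 B0 (normr_ge0 _) (normr_ge0 _)).
  by apply: powR_le_abs => //; exact: ler_normD.
rewrite rsumD !rsumZ.
have -> : (A + B) `^ p = k1 * A `^ p + k2 * B `^ p.
  by rewrite /k1 /k2; field; rewrite !gt_eqF ?powR_gt0.
by apply: lerD; apply: ler_wpM2l; rewrite ?sa ?sb // /k1 /k2 !mulr_ge0 ?invr_ge0 ?powR_ge0 ?ltW.
Qed.

Lemma lorentz_le_sum N (F : nat -> nat -> R) (A : nat -> R) :
  (forall j, (j < N)%N -> lorentz_le w p (F j) (A j)) ->
  lorentz_le w p (fun m => \sum_(j < N) F j m) (\sum_(j < N) A j).
Proof.
elim: N => [|N IH] H.
  rewrite big_ord0; apply: (lorentz_le_mono _ (lorentz_le0 (lexx 0))) => m.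
  by rewrite big_ord0.
rewrite big_ord_recr /=; have := lorentz_leD (IH (fun j jN => H j (ltnW jN))) (H N (leqnn _)).
by apply: lorentz_le_mono => m; rewrite big_ord_recr.
Qed.

(** The triangle inequality over [m] vectors with one entry. Crude, but enough to neglect an initial
    segment whose entries are small compared with [1 / m]. *)
Lemma lorentz_le_head (m : nat) a B : 0 <= B ->
  (forall l, (l < m)%N -> `|a l| <= B) -> (forall l, (m <= l)%N -> a l = 0) ->
  lorentz_le w p a (m%:R * B).
Proof.
move=> B0 lt ge.
have Hd l : lorentz_le w p (fun k => if k == l then B else 0) B.
  split=> // s us; pose f := fun k => (k == l)%:R : R.
  apply: (@le_trans _ _ (rsum w (fun k => B `^ p * f k) 0 s)).
    apply: rsum_le => // k _; rewrite /abspow /f; case: eqP => _.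
      by rewrite mulr1 ger0_norm.
    by rewrite mulr0 normr0 powR0 ?gt_eqF.
  rewrite rsumZ -[leRHS]mulr1; apply: ler_wpM2l; first exact: powR_ge0.
  apply: le_trans (rsum_indic Hw (e := [:: l]) us _) _; first by move=> k _; rewrite inE.
  by rewrite wsumS wsum0 add0r (weight0 Hw).
have := @lorentz_le_sum m (fun l k => if k == l then B else 0) (fun=> B).
rewrite sumr_const card_ord mulr_natl => /(_ (fun l _ => Hd l)).
apply: lorentz_le_mono => l; have [lm|ml] := ltnP l m; last by rewrite ge // normr0.
rewrite (bigD1 (Ordinal lm)) //= eqxx big1 ?addr0.
  by rewrite [leRHS]ger0_norm // lt.
by move=> i; rewrite -val_eqE /= eq_sym => /negbTE->.
Qed.

Hypothesis unb : forall M : R, exists N, M < wsum w N.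

Lemma rsum_ge_level a u e : 0 <= u -> (forall m, m \in e -> u <= `|a m|) ->
  u `^ p * wsum w (size e) <= rsum w (abspow p a) 0 e.
Proof.
move=> u0 H; rewrite -rsum_const1 -rsumZ; apply: rsum_le => // m me.
by rewrite mulr1; apply: powR_le_abs => //; exact: H.
Qed.

(** [N] entries above [u] would force the p-th power of the norm up to [u^p * wsum w N], and
    [wsum w] is unbounded. The bound is uniform in [a], which the pigeonhole argument relies on. *)
Lemma level_bound C u : 0 < u -> exists N, forall a e, lorentz_le w p a C ->
  uniq e -> (forall m, m \in e -> u < `|a m|) -> (size e < N)%N.
Proof.
move=> u0; have [N HN] := unb (C `^ p / u `^ p); exists N => a e [C0 H] ue He.
rewrite ltnNge; apply/negP => Ne.
move: HN; rewrite ltr_pdivrMr ?powR_gt0 // ltNge => /negP; apply.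
apply: le_trans (H e ue); apply: le_trans (rsum_ge_level (ltW u0) _).
  by rewrite mulrC; apply: ler_wpM2l; [exact: powR_ge0|exact: wsum_le].
by move=> m /He/ltW.
Qed.

Lemma level_list a C u : lorentz_le w p a C -> 0 < u ->
  exists2 e, uniq e & forall m, (m \in e) = (u < `|a m|).
Proof.
move=> Ha u0; apply: contrapT => H.
have [N HN] := level_bound C u0.
suff [e [ue se He]] : exists e, [/\ uniq e, size e = N & forall m, m \in e -> u < `|a m|].
  by have := HN a e Ha ue He; rewrite se ltnn.
elim: N {HN} => [|N [e [ue se He]]]; first by exists [::].
have [m me um] : exists2 m, m \notin e & u < `|a m|.
  apply: contrapT => Hm; apply: H; exists e => // m.
  apply/idP/idP => [/He//|um]; apply: contrapT => /negP me.
  by apply: Hm; exists m.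
exists (m :: e); split; rewrite /= ?me ?se // => l; rewrite inE.
by move=> /orP[/eqP->|/He].
Qed.

(** Take a list [s] that nearly attains the supremum. Appending a list from beyond [s] can gain only
    [e^p / 2], and it is delayed by just [size s] ranks; far out its entries are so small that this
    delay costs at most [e^p / 2] as well. *)
Lemma lorentz_tail a C e : lorentz_le w p a C -> 0 < e ->
  exists M, forall m, (M <= m)%N ->
    lorentz_le w p (fun l => if (m <= l)%N then a l else 0) e.
Proof.
move=> Ha e0; have [C0 HC] := Ha.
pose V := [set r | exists2 s, uniq s & r = rsum w (abspow p a) 0 s].
have supV : has_sup V.
  by split; [exists 0, [::]|exists (C `^ p) => r [s us ->]; exact: HC].
have e'0 : 0 < e `^ p / 2 by rewrite divr_gt0 ?powR_gt0.
have [_ [s us ->] Hs] := sup_adherent e'0 supV.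
(* Chosen so that entries at most [u] lose at most [e^p / 2] when delayed by [q] ranks. *)
pose q := size s; pose u := (e `^ p / 2 / q.+1%:R) `^ p^-1.
have u0 : 0 < u by rewrite powR_gt0 // divr_gt0.
have [E uE HE] := level_list Ha u0.
exists (\max_(i <- s ++ E) i).+1 => m Mm; split; first exact: ltW.
have Mlt i : i \in s ++ E -> (i < m)%N.
  by move=> iE; apply: leq_trans Mm; rewrite ltnS (@leq_bigmax_seq _ _ (fun=> true) id).
move=> t ut; pose t' := seq.filter (fun l => (m <= l)%N) t.
apply: (@le_trans _ _ (rsum w (abspow p a) 0 t')).
  apply: (@le_trans _ _ (rsum w (abspow p (fun l => if (m <= l)%N then a l else 0)) 0 t')).
    apply: rsum_filter => // [l|l _ /negbTE ml]; first exact: abspow_ge0.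
    by rewrite /abspow ml normr0 powR0 // gt_eqF.
  by apply: rsum_le => // l; rewrite mem_filter /abspow => /andP[->].
have ust : uniq (s ++ t').
  rewrite cat_uniq us filter_uniq // andbT /=; apply/hasPn => l.
  rewrite mem_filter => /andP[ml _]; apply/negP => ls.
  by have := Mlt l; rewrite mem_cat ls ltnNge ml => /(_ isT).
have up : u `^ p = e `^ p / 2 / q.+1%:R by rewrite powRK // divr_ge0 // ltW.
have := @rsum_shiftn _ _ Hw (abspow p a) (u `^ p) q t' (powR_ge0 _ _).
move=> /(_ _)/le_trans; apply.
  move=> l; rewrite mem_filter => /andP[ml _]; apply: powR_le_abs => //.
  rewrite leNgt -HE; apply/negP => lE.
  by have := Mlt l; rewrite mem_cat lE orbT ltnNge ml => /(_ isT).
have : rsum w (abspow p a) 0 (s ++ t') <= sup V.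
  by apply: sup_upper_bound => //; exists (s ++ t').
rewrite rsum_cat add0n => h1.
have : u `^ p * q%:R <= e `^ p / 2.
  rewrite up -mulrA -[leRHS]mulr1 ler_wpM2l ?(ltW e'0) //.
  by rewrite mulrC ler_pdivrMr // mul1r ler_nat.
rewrite -/q in h1 *; lra.
Qed.

End OneWeight.

End GaugeTheory.

(** * Disjoint blocks: upper and lower l_p estimates, tensor products *)

Section BlockEstimates.
Variables (R : realType) (p : R).
Hypothesis p1 : 1 <= p.
Implicit Types (w a b x : nat -> R) (y : nat -> nat -> R) (s t : seq nat).

Let p0 : 0 < p. Proof. exact: lt_le_trans p1. Qed.

Definition trunc (N : nat) a : nat -> R := fun m => if (m < N)%N then a m else 0.

Definition disjoint_upto (N : nat) y : Prop := forall j j' m, (j < N)%N -> (j' < N)%N ->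
  y j m != 0 -> y j' m != 0 -> j = j'.

Lemma sum_iota (F : nat -> R) N : \sum_(j < N) F j = \sum_(j <- iota 0 N) F j.
Proof. by rewrite -(big_mkord xpredT) /index_iota subn0. Qed.

Lemma rsum_one (c : nat -> R) q s : rsum (fun=> 1) c q s = \sum_(m <- s) c m.
Proof.
by elim: s q => [|m s IH] q /=; rewrite ?big_nil // big_cons mulr1 IH.
Qed.

Lemma lp_sum N a D : lorentz_le (fun=> 1) p (trunc N a) D ->
  \sum_(j < N) `|a j| `^ p <= D `^ p.
Proof.
move=> [D0 /(_ (iota 0 N) (iota_uniq _ _))]; rewrite rsum_one -sum_iota.
by apply: le_trans; apply: ler_sum => j _; rewrite /abspow /trunc ltn_ord.
Qed.

Lemma lp_le N a D : 0 <= D -> \sum_(j < N) `|a j| `^ p <= D `^ p ->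
  lorentz_le (fun=> 1) p (trunc N a) D.
Proof.
move=> D0 H; split=> // s us; apply: le_trans H.
rewrite (sum_iota (fun j => `|a j| `^ p)) rsum_one.
pose s' := seq.filter (fun m => (m < N)%N) s.
have -> : \sum_(m <- s) abspow p (trunc N a) m = \sum_(m <- s') abspow p a m.
  rewrite big_filter [RHS]big_mkcond; apply: eq_bigr => m _; rewrite /abspow /trunc.
  by case: ifP => // _; rewrite normr0 powR0 ?gt_eqF.
have : {subset s' <= iota 0 N}.
  by move=> m; rewrite mem_filter mem_iota /= add0n => /andP[].
move=> sub; rewrite [leRHS](bigID (fun m => m \in s')) /=.
have -> : \sum_(m <- s') abspow p a m = \sum_(m <- iota 0 N | m \in s') abspow p a m.
  rewrite -[RHS]big_filter; apply: perm_big; apply: uniq_perm.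
  - exact: filter_uniq.
  - by rewrite filter_uniq // iota_uniq.
  - by move=> m; rewrite [RHS]mem_filter; case ms : (m \in s') => //=; rewrite sub.
by rewrite lerDl sumr_ge0 // => m _; exact: powR_ge0.
Qed.

Lemma abspow_disjoint N a y m : disjoint_upto N y ->
  abspow p (fun l => \sum_(j < N) a j * y j l) m =
  \sum_(j < N) `|a j| `^ p * abspow p (y j) m.
Proof.
move=> dis; rewrite /abspow.
have [[j yj]|H] := pselect (exists j : 'I_N, y j m != 0).
  have z i : i != j -> y i m = 0.
    move=> ij; apply: contrapT => /eqP yi; move/eqP: ij; apply; apply/val_inj.
    by apply: (dis _ _ m); rewrite ?ltn_ord.
  rewrite (bigD1 j) //= [in RHS](bigD1 j) //= !big1 ?addr0.
  - by rewrite normrM powRM.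
  - by move=> i /z->; rewrite normr0 powR0 ?mulr0 // gt_eqF.
  - by move=> i /z->; rewrite mulr0.
have z (i : 'I_N) : y i m = 0.
  by apply: contrapT => /eqP yi; apply: H; exists i.
rewrite !big1; first by rewrite normr0 powR0 // gt_eqF.
- by move=> i _; rewrite z normr0 powR0 ?mulr0 // gt_eqF.
- by move=> i _; rewrite z mulr0.
Qed.

(** Abel summation in the form of a stronger induction: the sum is at most the last [b] times the
    partial sum of [e]. As that partial sum is nonpositive, passing to a smaller [b] only weakens
    the bound. *)
Lemma abel_le0 N (b e : nat -> R) :
  (forall r, (r.+1 < N)%N -> b r.+1 <= b r) -> (forall r, (r < N)%N -> 0 <= b r) ->
  (forall r, (r <= N)%N -> \sum_(i < r) e i <= 0) ->
  \sum_(r < N) b r * e r <= 0.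
Proof.
case: N => [|N] dec b0 E; first by rewrite big_ord0.
suff H M : (M <= N)%N -> \sum_(r < M.+1) b r * e r <= b M * \sum_(r < M.+1) e r.
  by apply: le_trans (H N (leqnn _)) _; rewrite mulr_ge0_le0 ?b0 ?E.
elim: M => [|M IH] MN; first by rewrite !big_ord_recr !big_ord0 /= !add0r.
rewrite big_ord_recr /= [in leRHS]big_ord_recr /= mulrDr lerD2r.
apply: le_trans (IH (ltnW MN)) _.
by apply: ler_wnM2r; [exact: E (leqW MN)|exact: dec].
Qed.

Section OneWeight.
Variable w : nat -> R.
Hypothesis Hw : weight w.

(** For disjoint blocks the sum along one list splits into the contributions of the blocks, each of
    which is bounded as if the list served that block alone. *)
Lemma disjoint_upper_lp N a y C D : disjoint_upto N y -> 0 <= C ->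
  (forall j, (j < N)%N -> lorentz_le w p (y j) C) ->
  lorentz_le (fun=> 1) p (trunc N a) D ->
  lorentz_le w p (fun m => \sum_(j < N) a j * y j m) (D * C).
Proof.
move=> dis C0 Hy Ha; have D0 := Ha.1; split=> [|s us]; first exact: mulr_ge0.
rewrite (eq_rsum Hw (c' := fun m => \sum_(j < N) `|a j| `^ p * abspow p (y j) m)).
  rewrite rsum_sum powRM //.
  apply: le_trans (ler_wpM2r (powR_ge0 _ _) (lp_sum Ha)); rewrite mulr_suml.
  apply: ler_sum => j _; rewrite rsumZ ler_wpM2l ?powR_ge0 //.
  exact: (Hy j (ltn_ord j)).2.
by move=> m _; exact: abspow_disjoint.
Qed.

(** The lists [t j] are concatenated in the order of the blocks. Block [j] then starts at a rank at
    most [lo j], and the term [B j * lo j] reserved in the last hypothesis pays for this delay, so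
    that a net amount [k] per block survives. *)
Lemma lower_lp N a b y (t : nat -> seq nat) (lo hi : nat -> nat) (B : nat -> R) k :
  (forall j, (j < N)%N -> uniq (t j)) ->
  (forall j l, (j < N)%N -> l \in t j -> (lo j <= l < hi j)%N) ->
  (forall j j', (j < j' < N)%N -> (hi j <= lo j')%N) ->
  (forall j l, (j < N)%N -> l \in t j -> `|b l| = `|a j| * `|y j l|) ->
  (forall j, (j < N)%N -> 0 <= B j) ->
  (forall j l, (j < N)%N -> l \in t j -> abspow p (y j) l <= B j) ->
  (forall j, (j < N)%N -> k + B j * (lo j)%:R <= rsum w (abspow p (y j)) 0 (t j)) ->
  exists2 s, uniq s & k * \sum_(j < N) `|a j| `^ p <= rsum w (abspow p b) 0 s.
Proof.
move=> ut tin sep bE B0 yB Hk.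
suff H M : (M <= N)%N -> exists s, [/\ uniq s,
    (forall l j, l \in s -> (M <= j < N)%N -> (l < lo j)%N) &
    k * \sum_(j < M) `|a j| `^ p <= rsum w (abspow p b) 0 s].
  by have [s [us _ Hs]] := H N (leqnn _); exists s.
elim: M => [|M IH] MN; first by exists [::]; split => //=; rewrite big_ord0 mulr0.
have [s [us ls Hs]] := IH (ltnW MN); exists (s ++ t M); split.
- rewrite cat_uniq us ut // andbT /=; apply/hasPn => l lt; apply/negP => /= lls.
  by have := ls l M lls; rewrite leqnn MN ltnNge => /(_ isT); case/andP: (tin M l MN lt) => ->.
- move=> l j; rewrite mem_cat => /orP[/ls H|lt] /andP[Mj jN].
    by apply: H; rewrite (ltnW Mj).
  by have /andP[_ h] := tin M l MN lt; apply: leq_trans h (sep _ _ _); rewrite Mj.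
(* The list built so far consists of distinct indices below [lo M]. *)
have ssz : (size s <= lo M)%N.
  rewrite -(size_iota 0 (lo M)); apply: uniq_leq_size => // l lls.
  by rewrite mem_iota add0n /=; apply: ls lls _; rewrite leqnn.
rewrite big_ord_recr /= mulrDr rsum_cat add0n lerD //.
apply: (@le_trans _ _ (`|a M| `^ p * rsum w (abspow p (y M)) (size s) (t M))).
  rewrite mulrC ler_wpM2l ?powR_ge0 //.
  have := rsum_shiftn Hw (size s) (B0 M MN) (fun l => @yB M l MN).
  have := Hk M MN; have : B M * (size s)%:R <= B M * (lo M)%:R.
    by rewrite ler_wpM2l ?B0 // ler_nat.
  by lra.
rewrite -rsumZ; apply: rsum_le => // l lt; by rewrite /abspow (bE M) // powRM.
Qed.

Section Tensor.
Hypothesis sub : forall N M, wsum w (N * M) <= wsum w N * wsum w M.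

Lemma cover_list (P : nat -> pred nat) c (L : seq nat) :
  (forall j, j \in L -> exists2 e : seq nat, (size e <= c)%N & forall m, P j m -> m \in e) ->
  exists2 E : seq nat, (size E <= size L * c)%N &
    forall m, has (P^~ m) L -> m \in E.
Proof.
elim: L => [|j L IH] H; first by exists [::].
have [|E sE HE] := IH; first by move=> i iL; apply: H; rewrite inE iL orbT.
have [e se He] := H j (mem_head _ _); exists (e ++ E).
  by rewrite size_cat /= mulSn leq_add.
by move=> m /= /orP[/He|/HE]; rewrite mem_cat => ->; rewrite ?orbT.
Qed.

(* Partial sums of the weights received by the blocks, taken in the order of decreasing
   [|a j|], are dominated by submultiplicativity; Abel summation does the rest. *)
Lemma tensor_level (P : nat -> pred nat) c N a D s :
  (forall j, (j < N)%N -> exists2 e : seq nat, (size e <= c)%N & forall m, P j m -> m \in e) ->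
  (forall j j' m, (j < N)%N -> (j' < N)%N -> P j m -> P j' m -> j = j') ->
  lorentz_le w p (trunc N a) D -> uniq s ->
  \sum_(j < N) `|a j| `^ p * rsum w (fun m => (P j m)%:R) 0 s <= wsum w c * D `^ p.
Proof.
move=> HP dis Ha us.
pose le_a := fun i j : nat => `|a j| <= `|a i|.
pose J := sort le_a (iota 0 N).
have perm_J : perm_eq J (iota 0 N) by rewrite /J perm_sort.
have sJ : size J = N by rewrite (perm_size perm_J) size_iota.
have uJ : uniq J by rewrite (perm_uniq perm_J) iota_uniq.
have memJ j : j \in J -> (j < N)%N by rewrite (perm_mem perm_J) mem_iota.
have sumJ (F : nat -> R) : \sum_(j < N) F j = \sum_(r < N) F (nth 0%N J r).
  by rewrite sum_iota -(perm_big _ perm_J) (big_nth 0%N) sJ big_mkord.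
pose b r := `|a (nth 0%N J r)| `^ p.
pose u j := rsum w (fun m => (P j m)%:R) 0 s.
rewrite (sumJ (fun j => `|a j| `^ p * u j)).
suff H : \sum_(r < N) b r * (u (nth 0%N J r) - wsum w c * w r) <= 0.
  have : \sum_(r < N) b r * w r <= D `^ p.
    apply: le_trans (Ha.2 J uJ); rewrite rsum_nth sJ; apply: ler_sum => r _.
    by rewrite /abspow /trunc memJ // mem_nth // sJ.
  move=> /(ler_wpM2l (wsum_ge0 Hw c)); apply: le_trans.
  rewrite mulr_sumr -subr_le0 -sumrB; apply: le_trans H.
  by apply: ler_sum => r _; rewrite /b; lra.
apply: (@abel_le0 N b (fun r => u (nth 0%N J r) - wsum w c * w r)).
- move=> r rN; apply: powR_le_abs => //.
  have : sorted le_a J by apply: sort_sorted => i j; exact: le_total.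
  move=> /(sortedP 0%N); apply; by rewrite sJ.
- by move=> r _; exact: powR_ge0.
move=> r rN; rewrite sumrB -mulr_sumr -/(wsum w r) subr_le0.
have -> : \sum_(i < r) u (nth 0%N J i) = \sum_(j <- take r J) u j.
  rewrite [RHS](big_nth 0%N) big_mkord size_take sJ.
  have -> : (if (r < N)%N then r else N) = r by apply/minn_idPl.
  by apply: eq_bigr => i _; rewrite nth_take.
have uT : uniq (take r J) by exact: take_uniq.
have memT j : j \in take r J -> (j < N)%N by move=> /mem_take/memJ.
have [|E sE HE] := @cover_list P c (take r J).
  by move=> j /memT; exact: HP.
rewrite -rsum_sum.
apply: (@le_trans _ _ (rsum w (fun m => (has (P^~ m) (take r J))%:R) 0 s)).
  apply: rsum_le => // m _; case: hasP => [[j jT Pj]|H].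
    rewrite (bigD1_seq j) //= Pj big_seq_cond big1 ?addr0 // => i /andP[iT ij].
    have [Pi|//] := boolP (P i m); move/eqP: ij; case.
    exact: (dis i j m (memT _ iT) (memT _ jT)).
  rewrite big_seq big1 // => j jT; have [Pj|//] := boolP (P j m).
  by case: H; exists j.
apply: (le_trans (rsum_indic Hw (e := E) us _)) => [m _|]; first exact: HE.
apply: (@le_trans _ _ (wsum w (c * r))); last exact: sub.
apply: wsum_le => //; apply: (leq_trans sE); rewrite mulnC leq_mul2l size_take sJ.
by apply/orP; right; exact: (geq_minl r N).
Qed.

Definition dyadic (tau : R) g : R := tau * 2 ^+ g.
(** Increments of p-th powers of the levels, the first one starting from 0. Summed over the levels
    below [u] they telescope to the p-th power of the next level, so [dyadic_round] is the p-th
    power of [u] rounded up. *)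
Definition dyadic_step (tau : R) g : R :=
  if g is 0%N then dyadic tau 1 `^ p
  else dyadic tau g.+1 `^ p - dyadic tau g `^ p.
Definition dyadic_round (tau : R) G (u : R) : R :=
  \sum_(g < G) dyadic_step tau g * (dyadic tau g < u)%R%:R.

Section Dyadic.
Variable tau : R.
Hypothesis tau0 : 0 < tau.

Lemma dyadic_gt0 g : 0 < dyadic tau g.
Proof. by rewrite mulr_gt0 // exprn_gt0. Qed.

Lemma dyadicS g : dyadic tau g.+1 = 2 * dyadic tau g.
Proof. by rewrite /dyadic exprS; ring. Qed.

Lemma dyadic_le g g' : (g <= g')%N -> dyadic tau g <= dyadic tau g'.
Proof. by move=> gg'; rewrite ler_pM2l // ler_weXn2l // ler1n. Qed.

Lemma dyadic_step_ge0 g : 0 <= dyadic_step tau g.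
Proof.
case: g => [|g]; first exact: powR_ge0.
by rewrite subr_ge0 powR_le_abs ?(ltW (dyadic_gt0 _)) // dyadic_le.
Qed.

Lemma dyadic_roundS G u : dyadic_round tau G.+1 u =
  if dyadic tau G < u then dyadic tau G.+1 `^ p else dyadic_round tau G u.
Proof.
rewrite /dyadic_round big_ord_recr /=; case: ltP => Gu; last by rewrite mulr0 addr0.
rewrite (eq_bigr (fun g : 'I_G => dyadic_step tau g)); last first.
  move=> g _; rewrite (le_lt_trans _ Gu) ?mulr1 // dyadic_le //; exact: ltnW.
rewrite mulr1 => {Gu}; elim: G => [|G IH]; first by rewrite big_ord0 add0r.
by rewrite big_ord_recr /= IH /=; ring.
Qed.

Lemma dyadic_round_le G u : 0 <= u -> dyadic_round tau G u <= (2 * u) `^ p.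
Proof.
move=> u0; elim: G => [|G IH]; first by rewrite /dyadic_round big_ord0 powR_ge0.
rewrite dyadic_roundS; case: ltP => // /ltW Gu.
by rewrite dyadicS powR_le_abs ?ler_pM2l // mulr_ge0 // ltW ?dyadic_gt0.
Qed.

Lemma dyadic_round_ge G u : tau < u <= dyadic tau G -> u `^ p <= dyadic_round tau G u.
Proof.
elim: G => [|G IH] /andP[tu uG].
  by move: uG; rewrite /dyadic expr0 mulr1 leNgt tu.
have u0 : 0 <= u by rewrite ltW // (lt_trans tau0).
rewrite dyadic_roundS; case: ltP => Gu; first by rewrite powR_le_abs.
by apply: IH; rewrite tu.
Qed.

Lemma rsum_sorted_level x (u : R) s : sorted (fun i j => `|x j| <= `|x i|) s ->
  rsum w (fun m => (u < `|x m|)%R%:R) 0 s = wsum w (count (fun m => u < `|x m|) s).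
Proof.
suff H q : sorted (fun i j => `|x j| <= `|x i|) s ->
    wsum w q + rsum w (fun m => (u < `|x m|)%R%:R) q s =
    wsum w (q + count (fun m => u < `|x m|) s).
  by move=> ss; rewrite -(H 0%N) // wsum0 add0r.
elim: s q => [|m s IH] q /=; first by rewrite addn0 addr0.
move=> ps; have ss := path_sorted ps.
have [um|mu] := ltP u `|x m|.
  by rewrite mul1r addrA -wsumS IH // addSnnS.
have Hs l : l \in s -> (u < `|x l|) = false.
  move=> ls; apply/negbTE; rewrite -leNgt; apply: le_trans mu.
  have tr : transitive (fun i j => `|x j| <= `|x i|) by move=> ? ? ? h1 /le_trans; apply.
  exact: (allP (order_path_min tr ps)).
rewrite mul0r add0r (eq_in_count (a2 := pred0)) ?count_pred0 ?addn0; last first.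
  by move=> l /Hs->.
rewrite (eq_rsum Hw (c' := fun=> 0 * 0)) ?(rsumZ w 0 (fun=> 0)) ?mul0r ?addr0 //.
by move=> l /Hs->.
Qed.

(** With the entries above [tau] listed in decreasing order, every level set occupies the first
    ranks of the same list. The layers thus add up to the sum of the rounded entries, and rounding
    up costs at most a factor 2. *)
Lemma dyadic_layers x C G (e : nat -> seq nat) : lorentz_le w p x C ->
  (forall g, uniq (e g)) -> (forall g m, (m \in e g) = (dyadic tau g < `|x m|)) ->
  \sum_(g < G) dyadic_step tau g * wsum w (size (e g)) <= (2 * C) `^ p.
Proof.
move=> [C0 Hx] ue He.
pose ge_x := fun i j : nat => `|x j| <= `|x i|.
pose s := sort ge_x (e 0%N).
have us : uniq s by rewrite sort_uniq.
have ss : sorted ge_x s by apply: sort_sorted => i j; exact: le_total.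
have sz g : wsum w (size (e g)) <= rsum w (fun m => (dyadic tau g < `|x m|)%R%:R) 0 s.
  rewrite rsum_sorted_level //; apply: wsum_le => //.
  rewrite -size_filter; apply: uniq_leq_size => // m; rewrite He mem_filter => h.
  by rewrite h mem_sort He (le_lt_trans _ h) // dyadic_le.
apply: (@le_trans _ _ (rsum w (fun m => dyadic_round tau G `|x m|) 0 s)).
  rewrite rsum_sum; apply: ler_sum => g _; rewrite rsumZ.
  by rewrite ler_wpM2l // dyadic_step_ge0.
rewrite powRM //; apply: le_trans (ler_wpM2l (powR_ge0 _ _) (Hx s us)).
rewrite -rsumZ; apply: rsum_le => // m _.
by apply: (le_trans (dyadic_round_le _ _)) => //; rewrite /abspow powRM.
Qed.

(** Rounded p-th powers are combinations of level indicators, and each level separately falls under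
    [tensor_level]. The counts [c g] are common to all blocks, so the layers recombine into the
    single factor [K^p]. *)
Lemma tensor_upper N G a y (c : nat -> nat) D K : disjoint_upto N y -> 0 <= K ->
  (forall j m, (j < N)%N -> y j m != 0 -> tau < `|y j m| <= dyadic tau G) ->
  (forall j g, (j < N)%N -> (g < G)%N -> exists2 e : seq nat, (size e <= c g)%N &
     forall m, dyadic tau g < `|y j m| -> m \in e) ->
  \sum_(g < G) dyadic_step tau g * wsum w (c g) <= K `^ p ->
  lorentz_le w p (trunc N a) D ->
  lorentz_le w p (fun m => \sum_(j < N) a j * y j m) (K * D).
Proof.
move=> dis K0 Hy Hc HK Ha; have D0 := Ha.1; split=> [|s us]; first exact: mulr_ge0.
apply: (@le_trans _ _ (rsum w (fun m => \sum_(j < N) `|a j| `^ p *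
    dyadic_round tau G `|y j m|) 0 s)).
  apply: rsum_le => // m _; rewrite abspow_disjoint //; apply: ler_sum => j _.
  rewrite ler_wpM2l ?powR_ge0 // /abspow.
  have [->|yj] := eqVneq (y j m) 0; last exact: dyadic_round_ge (Hy _ _ _ yj).
  rewrite normr0 powR0 ?gt_eqF //; apply: sumr_ge0 => g _.
  by rewrite mulr_ge0 // dyadic_step_ge0.
rewrite powRM //; apply: le_trans (ler_wpM2r (powR_ge0 _ _) HK).
rewrite rsum_sum mulr_suml.
under eq_bigr do rewrite rsumZ rsum_sum mulr_sumr.
rewrite exchange_big /=; apply: ler_sum => g _.
rewrite (eq_bigr (fun j : 'I_N => dyadic_step tau g * (`|a j| `^ p *
    rsum w (fun m => (dyadic tau g < `|y j m|)%R%:R) 0 s))); last first.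
  by move=> j _; rewrite rsumZ mulrCA.
rewrite -mulr_sumr -mulrA ler_wpM2l ?dyadic_step_ge0 //.
apply: (@tensor_level (fun j m => dyadic tau g < `|y j m|)) => //.
  by move=> j jN; exact: Hc.
have nz j m : dyadic tau g < `|y j m| -> y j m != 0.
  by move=> /(lt_trans (dyadic_gt0 g)); rewrite normr_gt0.
by move=> j j' m jN j'N /nz h /nz; exact: dis.
Qed.

End Dyadic.

End Tensor.

End OneWeight.

End BlockEstimates.

(** * The direct sum, spreading models and the gliding hump *)

Section DirectSum.
Variables (R : realType) (p : R) (n : nat) (w : nat -> nat -> R).
Hypothesis p1 : 1 <= p.
Hypothesis Hw : forall i, weight (w i).
Implicit Types (x y : 'I_n -> nat -> R) (C : R).

Let p0 : 0 < p. Proof. exact: lt_le_trans p1. Qed.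

Definition X_le x C : Prop := 0 <= C /\ forall i : 'I_n, lorentz_le (w i) p (x i) C.

Lemma X_le_in x C : X_le x C -> in_X w p x.
Proof. by move=> [_ H] i; exact: lorentz_le_in (H i). Qed.

Lemma X_le_norm x C : X_le x C -> normX w p x <= C.
Proof.
by move=> [C0 H]; apply: bigmax_le => // i _; exact: lorentz_le_norm (H i).
Qed.

Lemma normX_ge0 x : 0 <= normX w p x.
Proof. exact: bigmax_ge_id. Qed.

Lemma normX_le x : in_X w p x -> X_le x (normX w p x).
Proof.
move=> H; split=> [|i]; first exact: normX_ge0.
apply: (lorentz_leW p1 _ (lorentz_norm_le (Hw i) p0 (H i))).
exact: (le_bigmax _ (fun i : 'I_n => lorentz_norm (w i) p (x i))).
Qed.

Lemma X_leW x C C' : C <= C' -> X_le x C -> X_le x C'.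
Proof.
by move=> CC' [C0 H]; split; [exact: le_trans CC'|move=> i; exact: lorentz_leW (H i)].
Qed.

Lemma X_le_abs x C i m : X_le x C -> `|x i m| <= C.
Proof. by move=> [_ H]; exact: lorentz_le_abs (H i). Qed.

Lemma X_leD x y A B : X_le x A -> X_le y B -> X_le (vadd x y) (A + B).
Proof.
by move=> [A0 HA] [B0 HB]; split=> [|i]; [exact: addr_ge0|exact: lorentz_leD].
Qed.

Lemma X_leZ k x A : X_le x A -> X_le (vscale k x) (`|k| * A).
Proof.
by move=> [A0 HA]; split=> [|i]; [exact: mulr_ge0|exact: lorentz_leZ].
Qed.

Lemma X_le0 C : 0 <= C -> X_le (@vzero R n) C.
Proof. by move=> C0; split=> // i; exact: lorentz_le0. Qed.

Lemma in_X_D x y : in_X w p x -> in_X w p y -> in_X w p (vadd x y).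
Proof. by move=> /normX_le hx /normX_le hy; exact: X_le_in (X_leD hx hy). Qed.

Lemma in_X_Z k x : in_X w p x -> in_X w p (vscale k x).
Proof. by move=> /normX_le hx; exact: X_le_in (X_leZ k hx). Qed.

Lemma normXD x y : in_X w p x -> in_X w p y ->
  normX w p (vadd x y) <= normX w p x + normX w p y.
Proof. by move=> /normX_le hx /normX_le hy; exact: X_le_norm (X_leD hx hy). Qed.

Lemma normXZ k x : in_X w p x -> normX w p (vscale k x) = `|k| * normX w p x.
Proof.
move=> hx; apply/eqP; rewrite eq_le; apply/andP; split.
  exact: X_le_norm (X_leZ k (normX_le hx)).
have [->|k0] := eqVneq k 0; first by rewrite normr0 mul0r normX_ge0.
have := X_le_norm (X_leZ k^-1 (normX_le (in_X_Z k hx))).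
have -> : vscale k^-1 (vscale k x) = x.
  by apply/funext => i; apply/funext => m; rewrite /vscale mulKf.
by rewrite normfV -ler_pdivlMl ?normr_gt0.
Qed.

Lemma X_le_vcomb N (a : nat -> R) k (z : nat -> 'I_n -> nat -> R) (A : nat -> R) :
  (forall j, (j < N)%N -> X_le (z (k j)) (A j)) ->
  X_le (vcomb N a k z) (\sum_(j < N) `|a j| * A j).
Proof.
move=> H; split=> [|i].
  by apply: sumr_ge0 => j _; rewrite mulr_ge0 // (H j (ltn_ord j)).1.
apply: (lorentz_le_sum p1 (Hw i) (F := fun j m => a j * z (k j) i m) (A := fun j => `|a j| * A j)).
by move=> j jN; apply: lorentz_leZ => //; exact: (H j jN).2.
Qed.

Section SpreadingModel.
Variable z : nat -> 'I_n -> nat -> R.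
Hypothesis Hz : normalized w p z.
Variables (Y : normedModType R) (zt : nat -> Y).

Lemma normalized_le k : X_le (z k) 1.
Proof. by have [/normX_le h e] := Hz k; rewrite e in h. Qed.

Lemma in_X_vcomb N a k : in_X w p (vcomb N a k z).
Proof. by apply: X_le_in; apply: X_le_vcomb => j _; exact: normalized_le. Qed.

(** Homogeneity lifts the restriction to coefficients in [-1,1], and [eps 0], the largest of the
    [eps N], yields one constant for all [N]. *)
Lemma spreading_bounds : generates_spreading_model w p z zt ->
  exists2 K : R, 0 <= K & forall N (a : nat -> R) k, (0 < N)%N -> (N <= k 0%N)%N ->
    (forall i, (k i < k i.+1)%N) ->
    `| \sum_(i < N) a i *: zt i | <= K * normX w p (vcomb N a k z) /\
    normX w p (vcomb N a k z) <= K * `| \sum_(i < N) a i *: zt i |.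
Proof.
move=> [eps [eps0 epsS _ H]].
have epsle N : eps N <= eps 0%N by elim: N => // N; exact: le_trans.
have K0 : 0 < 1 + eps 0%N by rewrite ltr_pwDl.
exists (1 + eps 0%N); first exact: ltW.
move=> N a k N0 Nk kk.
(* The added 1 keeps the scale positive when all coefficients vanish. *)
pose c := 1 + \sum_(i < N) `|a i|.
have s0 : 0 <= \sum_(i < N) `|a i| by apply: sumr_ge0.
have c0 : 0 < c by rewrite ltr_pwDl.
pose a' i := c^-1 * a i.
have a'1 i : (i < N)%N -> `|a' i| <= 1.
  move=> iN; rewrite normrM normfV (gtr0_norm c0) ler_pdivrMl // mulr1 /c.
  rewrite (bigD1 (Ordinal iN)) //= addrCA lerDl addr_ge0 //; exact: sumr_ge0.
have E1 : \sum_(i < N) a i *: zt i = c *: (\sum_(i < N) a' i *: zt i).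
  by rewrite scaler_sumr; apply: eq_bigr => i _; rewrite scalerA mulVKf // gt_eqF.
have E2 : vcomb N a k z = vscale c (vcomb N a' k z).
  apply/funext => i; apply/funext => m; rewrite /vcomb /vscale mulr_sumr.
  by apply: eq_bigr => j _; rewrite mulrA mulVKf // gt_eqF.
have /andP[] := H N a' k a'1 N0 (leqW Nk) (fun i _ => kk i).
rewrite E1 E2 normrZ (normXZ c (in_X_vcomb N a' k)) (gtr0_norm c0) !(mulrCA _ c) !ler_pM2l //.
have eN : 0 < 1 + eps N by rewrite ltr_pwDl.
have eNK : 1 + eps N <= 1 + eps 0%N by rewrite lerD2l.
rewrite ler_pdivrMl // => h1 h2; split.
  by apply: le_trans h1 _; rewrite ler_wpM2r ?normX_ge0.
by apply: le_trans h2 _; rewrite ler_wpM2r.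
Qed.

Section Estimates.
Hypothesis unb : forall i M, exists N, M < wsum (w i) N.
Hypothesis null : weakly_null w p z.
(** Evaluation at one place is a bounded functional, so weak nullity gives convergence to 0 at each
    of finitely many places. *)
Lemma coordinates_null m (e : R) : 0 < e ->
  \forall k \near \oo, forall (i : 'I_n) (l : 'I_m), `|z k i l| <= e.
Proof.
move=> e0; apply: filter_forall => i; apply: filter_forall => l.
have /null/cvgrPdist_le/(_ e e0) : bounded_linear_functional w p (fun x => x i (l : nat)).
  split=> [c x y _ _ //|]; exists 1 => x hx; rewrite mul1r.
  exact: X_le_abs (normX_le hx).
by apply: filterS => k; rewrite sub0r normrN.
Qed.

Definition block (lo hi : nat) (a : nat -> R) : nat -> R :=
  fun l => if (lo <= l < hi)%N then a l else 0.

Lemma block_le lo hi (a : nat -> R) l : `|block lo hi a l| <= `|a l|.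
Proof. by rewrite /block; case: ifP => // _; rewrite normr0. Qed.

Definition off_block_le k lo hi (e : R) : Prop :=
  forall i : 'I_n, lorentz_le (w i) p (fun l => z k i l - block lo hi (z k i) l) e.

(** Before [m] the vector is small by weak nullity, since only [m] places are involved; after a late
    [m'] it is small because Lorentz tails vanish. *)
Lemma near_off_block m (e : R) : 0 < e -> \forall k \near \oo,
  exists M, forall m', (M <= m')%N -> off_block_le k m m' e.
Proof.
move=> e0; have e20 : 0 < e / 2 by rewrite divr_gt0.
have d0 : 0 < e / 2 / m.+1%:R by rewrite divr_gt0.
have := coordinates_null m d0; apply: filterS => k Hk.
have : \forall m' \near \oo, forall i : 'I_n,
    lorentz_le (w i) p (fun l => if (m' <= l)%N then z k i l else 0) (e / 2).
  apply: filter_forall => i.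
  have [M HM] := lorentz_tail p1 (Hw i) (@unb i) ((normalized_le k).2 i) e20.
  by exists M.
move=> [M _ HM]; exists (maxn m M) => m' mM i.
have hd : lorentz_le (w i) p (fun l => if (l < m)%N then z k i l else 0) (e / 2).
  apply: (lorentz_leW p1 _ (lorentz_le_head p1 (Hw i) (m := m) (ltW d0) _ _)).
  - by rewrite mulrC mulrAC ler_pdivrMr // ler_wpM2l ?ler_nat // ltW.
  - by move=> l lm; rewrite lm (Hk i (Ordinal lm)).
  - by move=> l ml; rewrite ltnNge ml.
have tl := HM m' (leq_trans (leq_maxr _ _) mM) i.
rewrite [e]splitr; apply: lorentz_le_mono (lorentz_leD p1 (Hw i) hd tl) => // l.
have mm' : (m <= m')%N := leq_trans (leq_maxl _ _) mM.
rewrite /block; case: (ltnP l m) => lm /=.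
  by rewrite subr0 leqNgt (leq_trans lm mm') /= addr0.
by case: (ltnP l m') => lm' /=; rewrite ?subrr ?addr0 ?subr0 ?add0r.
Qed.

(** The state of the recursion is the current left end together with the least index allowed next;
    raising the latter past the chosen [k] makes [k] strictly increasing. *)
Lemma ex_chain (Q : nat -> nat -> nat -> Prop) :
  (forall m K, exists k m', [/\ (K <= k)%N, (m < m')%N & Q m k m']) ->
  forall K0, exists k mm : nat -> nat, [/\ (K0 <= k 0%N)%N,
    forall j, (k j < k j.+1)%N, forall j, (mm j < mm j.+1)%N &
    forall j, Q (mm j) (k j) (mm j.+1)].
Proof.
move=> H L.
have [|f Hf] := @choice _ _ (fun s t : nat * nat =>
    [/\ (s.2 <= t.1)%N, (s.1 < t.2)%N & Q s.1 t.1 t.2]).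
  by move=> -[m q]; have [k [m' h]] := H m q; exists (k, m').
pose st := fix st j := if j is j'.+1 then ((f (st j')).2, (f (st j')).1.+1) else (0%N, L).
exists (fun j => (f (st j)).1), (fun j => (st j).1); split.
- by have [] := Hf (st 0%N).
- by move=> j; have [] := Hf (st j.+1).
- by move=> j; have [] := Hf (st j).
- by move=> j; have [] := Hf (st j).
Qed.

(** [Q] is the extra demand of each application. It is met by some late [k] and then all late [m'],
    while smallness off the block holds for all late [k], so the two can be had together. *)
Lemma gliding_hump (Q : nat -> nat -> nat -> Prop) (e : R) K1 : 0 < e ->
  (forall m K, exists2 k, (K <= k)%N & exists M, forall m', (M <= m')%N -> Q m k m') ->
  exists k mm : nat -> nat, [/\ (K1 <= k 0%N)%N,
    forall j, (k j < k j.+1)%N, forall j, (mm j < mm j.+1)%N &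
    forall j, Q (mm j) (k j) (mm j.+1) /\ off_block_le (k j) (mm j) (mm j.+1) e].
Proof.
move=> e0 H; apply: ex_chain (fun m k m' => Q m k m' /\ off_block_le k m m' e) _ K1.
move=> m L; have [L' _ HL'] := near_off_block m e0.
have [k Lk [M HM]] := H m (maxn L L').
have [M' HM'] := HL' k (leq_trans (leq_maxr _ _) Lk).
exists k, (maxn m.+1 (maxn M M')); split.
- exact: leq_trans (leq_maxl _ _) Lk.
- exact: leq_maxl.
- split; [apply: HM|apply: HM']; lia.
Qed.

Section Blocks.
Variables (N : nat) (k mm : nat -> nat) (e : R) (a : nat -> R).
Hypothesis mmS : forall j, (mm j < mm j.+1)%N.
Hypothesis off : forall j, off_block_le (k j) (mm j) (mm j.+1) e.

Definition blocks (i : 'I_n) : nat -> nat -> R :=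
  fun j => block (mm j) (mm j.+1) (z (k j) i).

Lemma mm_le j j' : (j <= j')%N -> (mm j <= mm j')%N.
Proof. exact: (homo_leq (leqnn) (fun _ _ _ => @leq_trans _ _ _) (fun j => ltnW (mmS j))). Qed.

Lemma mm_sep j j' : (j < j')%N -> (mm j.+1 <= mm j')%N.
Proof. exact: mm_le. Qed.

Lemma mm_inj j j' l : (mm j <= l < mm j.+1)%N -> (mm j' <= l < mm j'.+1)%N -> j = j'.
Proof.
move=> /andP[h1 h2] /andP[h3 h4].
case: (ltngtP j j') => // /mm_sep h.
  by have := leq_trans h2 (leq_trans h h3); rewrite ltnn.
by have := leq_trans h4 (leq_trans h h1); rewrite ltnn.
Qed.

Lemma blocks_supp i j l : blocks i j l != 0 -> (mm j <= l < mm j.+1)%N.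
Proof. by rewrite /blocks /block; case: ifP => // _; rewrite eqxx. Qed.

Lemma blocks_disjoint i : disjoint_upto N (blocks i).
Proof. by move=> j j' l _ _ /blocks_supp h /blocks_supp; exact: mm_inj. Qed.

Lemma blocks_le1 (i : 'I_n) j : lorentz_le (w i) p (blocks i j) 1.
Proof.
apply: lorentz_le_mono ((normalized_le (k j)).2 i) => //; exact: block_le.
Qed.

Lemma blocks_sumE i j l : (j < N)%N -> (mm j <= l < mm j.+1)%N ->
  \sum_(j' < N) a j' * blocks i j' l = a j * z (k j) i l.
Proof.
move=> jN jl; rewrite (bigD1 (Ordinal jN)) //= {1}/blocks /block jl big1 ?addr0 //.
move=> j'; rewrite -val_eqE /= => j'j; have [->|/blocks_supp h] := eqVneq (blocks i j' l) 0.
  by rewrite mulr0.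
by move/eqP: j'j; case; exact: mm_inj h jl.
Qed.

Lemma blocks_error (i : 'I_n) : lorentz_le (w i) p
  (fun l => \sum_(j < N) a j * (z (k j) i l - blocks i j l)) (\sum_(j < N) `|a j| * e).
Proof.
apply: (lorentz_le_sum p1 (Hw i) (F := fun j l => a j * (z (k j) i l - blocks i j l))
  (A := fun j => `|a j| * e)).
by move=> j _; apply: lorentz_leZ => //; exact: off.
Qed.

Lemma blocks_up (i : 'I_n) C : lorentz_le (w i) p (fun l => \sum_(j < N) a j * blocks i j l) C ->
  lorentz_le (w i) p (vcomb N a k z i) (C + \sum_(j < N) `|a j| * e).
Proof.
move=> /(lorentz_leD p1 (Hw i))/(_ (blocks_error i)).
apply: lorentz_le_mono => // l; rewrite /vcomb -big_split /=.
by rewrite le_eqVlt; apply/orP; left; apply/eqP; congr `|_|; apply: eq_bigr => j _; ring.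
Qed.

Lemma blocks_down (i : 'I_n) C : lorentz_le (w i) p (vcomb N a k z i) C ->
  lorentz_le (w i) p (fun l => \sum_(j < N) a j * blocks i j l) (C + \sum_(j < N) `|a j| * e).
Proof.
move=> /(lorentz_leD p1 (Hw i))/(_ (lorentz_leZ (Hw i) (-1) (blocks_error i))).
rewrite normrN1 mul1r; apply: lorentz_le_mono => // l; rewrite /vcomb mulN1r -sumrB.
by rewrite le_eqVlt; apply/orP; left; apply/eqP; congr `|_|; apply: eq_bigr => j _; ring.
Qed.

End Blocks.

Lemma error_sum_le N (a : nat -> R) (D e : R) : 0 <= e -> (forall j, (j < N)%N -> `|a j| <= D) ->
  0 <= D -> \sum_(j < N) `|a j| * (e / N.+1%:R) <= D * e.
Proof.
move=> e0 H D0; apply: (@le_trans _ _ (\sum_(j < N) D * (e / N.+1%:R))).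
  by apply: ler_sum => j _; rewrite ler_wpM2r ?H // divr_ge0.
rewrite sumr_const card_ord -(mulr_natr (D * _)) -mulrA ler_wpM2l // mulrAC.
by rewrite ler_pdivrMr // ler_wpM2l // ler_nat.
Qed.

Definition dominates_weight (v : nat -> R) : Prop := exists2 C : R, 0 <= C &
  forall N (a : nat -> R), lorentz_le v p (trunc N a) (C * `| \sum_(i < N) a i *: zt i |).

Variable K : R.
Hypothesis K0 : 0 <= K.
Hypothesis HK : forall N (a : nat -> R) k, (0 < N)%N -> (N <= k 0%N)%N ->
    (forall i, (k i < k i.+1)%N) ->
    `| \sum_(i < N) a i *: zt i | <= K * normX w p (vcomb N a k z) /\
    normX w p (vcomb N a k z) <= K * `| \sum_(i < N) a i *: zt i |.

Lemma spread_upper N (a : nat -> R) k C : (0 < N)%N -> (N <= k 0%N)%N -> (forall i, (k i < k i.+1)%N) ->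
  X_le (vcomb N a k z) C -> `| \sum_(i < N) a i *: zt i | <= K * C.
Proof.
move=> N0 Nk kk /X_le_norm h; have [h1 _] := HK a N0 Nk kk.
by apply: le_trans h1 _; rewrite ler_wpM2l.
Qed.

Lemma spread_lower N (a : nat -> R) k (i : 'I_n) : (0 < N)%N -> (N <= k 0%N)%N -> (forall i, (k i < k i.+1)%N) ->
  lorentz_le (w i) p (vcomb N a k z i) (K * `| \sum_(i < N) a i *: zt i |).
Proof.
move=> N0 Nk kk; have [_ h] := HK a N0 Nk kk.
by have [_] := X_leW h (normX_le (in_X_vcomb N a k)); apply.
Qed.

Lemma trunc_abs N (a : nat -> R) v D j : weight v -> lorentz_le v p (trunc N a) D -> (j < N)%N -> `|a j| <= D.
Proof. by move=> Hv /(lorentz_le_abs j Hv p0); rewrite /trunc => + jN; rewrite jN. Qed.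

(** In the constant 2, one unit comes from the disjoint blocks and one from what lies off them. *)
Lemma upper_lp_estimate N (a : nat -> R) D : lorentz_le (fun=> 1) p (trunc N a) D ->
  `| \sum_(i < N) a i *: zt i | <= K * 2 * D.
Proof.
move=> Ha; have D0 := Ha.1; have [->|N0] := posnP N.
  by rewrite big_ord0 normr0 !mulr_ge0.
have e0 : 0 < 1 / N.+1%:R :> R by rewrite divr_gt0.
have [|k [mm [Nk kk mmS off]]] := @gliding_hump (fun _ _ _ => True) _ N e0.
  by move=> m L; exists L => //; exists 0%N.
rewrite -mulrA; apply: spread_upper Nk kk _ => //; split=> [|i]; first by rewrite mulr_ge0.
have dis : disjoint_upto N (blocks k mm i) by exact: blocks_disjoint.
have /(blocks_up (fun j => (off j).2)) := disjoint_upper_lp p1 (Hw i) dis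
  ler01 (fun j _ => blocks_le1 k mm i j) Ha.
apply: lorentz_leW => //; have := error_sum_le ler01 (fun j => trunc_abs (weight_const1 R) Ha) D0.
by lra.
Qed.

Lemma trunc_lorentz N (a : nat -> R) v : weight v -> exists C, lorentz_le v p (trunc N a) C.
Proof.
move=> Hv; exists (N%:R * \sum_(j < N) `|a j|).
apply: lorentz_le_head => //; first by apply: sumr_ge0.
  move=> l lN; rewrite /trunc lN (bigD1 (Ordinal lN)) //= lerDl; exact: sumr_ge0.
by move=> l Nl; rewrite /trunc ltnNge Nl.
Qed.

Definition has_peaks (i : 'I_n) : Prop := exists2 d : R, 0 < d &
  forall L, exists2 k, (L <= k)%N & exists l, d < `|z k i l|.

(** Sending [j] to a peak inside the j-th block is injective, so [d] times the coefficients is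
    dominated, entry by entry, by the blocks. The error is at most half of the left side and is
    absorbed there. *)
Lemma peaks_lower i : has_peaks i -> dominates_weight (w i).
Proof.
move=> [d d0 Hd]; exists (K * 2 / d); first by rewrite divr_ge0 ?mulr_ge0 // ltW.
move=> N a; set T := `| _ |; have T0 : 0 <= T by exact: normr_ge0.
have [->|N0] := posnP N.
  apply: (lorentz_le_mono p1 (Hw i) _ (lorentz_le0 p1 (Hw i) _)).
    by move=> m; rewrite /trunc.
  by rewrite mulr_ge0 // divr_ge0 ?mulr_ge0 // ltW.
have d20 : 0 < d / 2 by rewrite divr_gt0.
have e0 : 0 < d / 2 / N.+1%:R by rewrite divr_gt0.
have [|k [mm [Nk kk mmS off]]] :=
  @gliding_hump (fun _ k _ => exists l, d < `|z k i l|) _ N e0.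
  by move=> m L; have [k Lk h] := Hd L; exists k => //; exists 0%N.
have [|l Hl] := @choice _ _ (fun j l => (mm j <= l < mm j.+1)%N /\ d < `|z (k j) i l|).
  move=> j; have [[l dl] /(_ i) offj] := off j; exists l; split=> //.
  (* A peak outside the block would be an entry of the off-block remainder, and those are at most
     [d / 2]. *)
  apply: contraT => /negbTE out.
  have := lorentz_le_abs l (Hw i) p0 offj; rewrite /block out subr0 leNgt.
  rewrite (lt_trans _ dl) //; apply: (@le_lt_trans _ _ (d / 2)); last lra.
  by rewrite ler_pdivrMr // ler_peMr ?(ltW d20) // ler1n.
(* Finiteness of the coefficient norm [D] is what permits moving [D * d / 2] to the other side. *)
have [C HC] := trunc_lorentz N a (Hw i).
have HD := lorentz_norm_le (Hw i) p0 (lorentz_le_in (Hw i) p0 HC).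
set D := lorentz_norm _ _ _ in HD; have D0 := HD.1.
apply: (lorentz_leW p1 _ HD).
have down := blocks_down (fun j => (off j).2) (spread_lower a i N0 Nk kk).
have err := error_sum_le (ltW d20) (fun j => trunc_abs (Hw i) HD) D0.
have /(lorentz_leZ (Hw i) d^-1) : lorentz_le (w i) p (fun j => d * trunc N a j) (K * T + D * (d / 2)).
  apply: (lorentz_leW p1 (C := K * T + \sum_(j < N) `|a j| * (d / 2 / N.+1%:R))); first by rewrite lerD2l.
  apply: (lorentz_le_inj p1 (Hw i) (g := l) down) => [j|j j' _ _ lj].
    rewrite /trunc; case: ifP => jN; last by rewrite mulr0 eqxx.
    move=> _; have [jl dl] := Hl j; rewrite (blocks_sumE k a mmS i jN jl) !normrM mulrC.
    by rewrite ler_wpM2l // gtr0_norm // ltW.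
  by have [h1 _] := Hl j; have [h2 _] := Hl j'; rewrite lj in h1; exact: mm_inj h1 h2.
rewrite gtr0_norm ?invr_gt0 // => h.
have {h} /(lorentz_le_norm (Hw i) p0) : lorentz_le (w i) p (trunc N a) (d^-1 * (K * T + D * (d / 2))).
  by apply: lorentz_le_mono h => // m; rewrite mulKf // gt_eqF.
rewrite -/D ler_pdivlMl // => h.
by rewrite mulrAC ler_pdivlMr //; lra.
Qed.

End Estimates.

End SpreadingModel.

End DirectSum.

(** * Flat parts against peaks *)

Section UpperLowerEstimates.
Variables (R : realType) (p : R) (n : nat) (w : nat -> nat -> R).
Hypothesis p1 : 1 <= p.
Hypothesis Hw : forall i, weight (w i).
Hypothesis unb : forall i M, exists N, M < wsum (w i) N.
Variable z : nat -> 'I_n -> nat -> R.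
Hypothesis Hz : normalized w p z.
Hypothesis null : weakly_null w p z.
Variables (Y : normedModType R) (zt : nat -> Y) (K : R).
Hypothesis K0 : 0 <= K.
Hypothesis HK : forall N (a : nat -> R) k, (0 < N)%N -> (N <= k 0%N)%N ->
    (forall i, (k i < k i.+1)%N) ->
    `| \sum_(i < N) a i *: zt i | <= K * normX w p (vcomb N a k z) /\
    normX w p (vcomb N a k z) <= K * `| \sum_(i < N) a i *: zt i |.

Let p0 : 0 < p. Proof. exact: lt_le_trans p1. Qed.

(** At each threshold only infinitely many terms are asked for, which is what the gliding hump can
    use; the negation then controls all late terms. *)
Definition has_flat_parts (i : 'I_n) : Prop := exists2 c : R, 0 < c &
  forall tau, 0 < tau -> forall L, exists2 k, (L <= k)%N & exists t,
    [/\ uniq t, forall l, l \in t -> `|z k i l| <= tau &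
        c <= rsum (w i) (abspow p (z k i)) 0 t].

(** The part of the list before [m] is dropped: it has at most [m] entries, each small by weak
    nullity. The surplus in the conclusion is what [lower_lp] needs to pay for a delay by [m]
    ranks. *)
Lemma flat_far (i : 'I_n) (c : R) m L : 0 < c ->
  (forall tau, 0 < tau -> forall L, exists2 k, (L <= k)%N & exists t,
    [/\ uniq t, forall l, l \in t -> `|z k i l| <= tau &
        c <= rsum (w i) (abspow p (z k i)) 0 t]) ->
  exists2 k, (L <= k)%N & exists t, [/\ uniq t, forall l, l \in t -> (m <= l)%N,
    forall l, l \in t -> abspow p (z k i) l <= c / 4 / m.+1%:R &
    c / 2 + c / 4 / m.+1%:R * m%:R <= rsum (w i) (abspow p (z k i)) 0 t].
Proof.
(* With this [B], dropping the head and a delay by [m] ranks cost at most [c / 4] each, which leaves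
   [c / 2]. *)
move=> c0 H; set B := c / 4 / m.+1%:R.
have B0 : 0 < B by rewrite !divr_gt0.
have Bm : B * m%:R <= c / 4.
  by rewrite /B mulrAC ler_pdivrMr // ler_wpM2l ?ler_nat // divr_ge0 // ltW.
pose tau := B `^ p^-1; have tau0 : 0 < tau by rewrite powR_gt0.
have tauB : tau `^ p = B by rewrite powRK // ltW.
have [L' _ HL'] := coordinates_null p1 Hw null m tau0.
have [k Lk [t [ut tt Ht]]] := H tau tau0 (maxn L L').
exists k; first exact: leq_trans (leq_maxl _ _) Lk.
have hd (l : nat) : (l < m)%N -> abspow p (z k i) l <= B.
  move=> lm; rewrite -tauB; apply: powR_le_abs => //.
  exact: (HL' k (leq_trans (leq_maxr _ _) Lk) i (Ordinal lm)).
pose t' := seq.filter (fun l => (m <= l)%N) t; exists t'; split.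
- exact: filter_uniq.
- by move=> l; rewrite mem_filter => /andP[].
- move=> l; rewrite mem_filter => /andP[_ /tt h]; rewrite -tauB.
  exact: powR_le_abs.
pose f l := (m <= l)%N%:R * abspow p (z k i) l.
have h1 : rsum (w i) f 0 t <= rsum (w i) (abspow p (z k i)) 0 t'.
  apply: (@le_trans _ _ (rsum (w i) f 0 t')).
    apply: rsum_filter => // [l|l _ /negbTE]; first by rewrite mulr_ge0 ?abspow_ge0.
    by rewrite /f => ->; rewrite mul0r.
  by apply: rsum_le => // l; rewrite mem_filter /f => /andP[-> _]; rewrite mul1r.
have h2 : rsum (w i) (fun l => B * (l < m)%N%:R) 0 t <= c / 4.
  rewrite rsumZ; apply: le_trans Bm; rewrite ler_wpM2l ?(ltW B0) //.
  apply: (le_trans (rsum_indic (Hw i) (e := iota 0 m) ut _)).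
    by move=> l _; rewrite mem_iota.
  by rewrite size_iota wsum_le_nat.
have h3 : rsum (w i) (abspow p (z k i)) 0 t <=
    rsum (w i) (fun l => f l + B * (l < m)%N%:R) 0 t.
  apply: rsum_le => // l _; rewrite /f; have [ml|lm] := leqP m l.
    by rewrite mul1r mulr0 addr0.
  by rewrite mul0r add0r mulr1 hd.
rewrite rsumD in h3; lra.
Qed.

Lemma flat_lower i : has_flat_parts i -> dominates_weight p zt (fun=> 1).
Proof.
move=> [c c0 Hc]; pose r := (c / 2) `^ p^-1.
have c20 : 0 < c / 2 by rewrite divr_gt0.
have r0 : 0 < r by rewrite powR_gt0.
exists (K * 2 / r); first by rewrite divr_ge0 ?mulr_ge0 // ltW.
move=> N a; set T := `| _ |; have T0 : 0 <= T by exact: normr_ge0.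
have [->|N0] := posnP N.
  apply: (lorentz_le_mono p1 (weight_const1 R) _ (lorentz_le0 p1 (weight_const1 R) _)).
    by move=> m; rewrite /trunc.
  by rewrite mulr_ge0 // divr_ge0 ?mulr_ge0 // ltW.
have r20 : 0 < r / 2 by rewrite divr_gt0.
have e0 : 0 < r / 2 / N.+1%:R by rewrite divr_gt0.
pose Q m k m' := exists t, [/\ uniq t, forall l, l \in t -> (m <= l < m')%N,
    forall l, l \in t -> abspow p (z k i) l <= c / 4 / m.+1%:R &
    c / 2 + c / 4 / m.+1%:R * m%:R <= rsum (w i) (abspow p (z k i)) 0 t].
have [|k [mm [Nk kk mmS off]]] := gliding_hump p1 Hw Hz unb null (Q := Q) N e0.
  move=> m L; have [k Lk [t [ut tm tB tc]]] := flat_far m L c0 Hc.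
  exists k => //; exists (\max_(l <- t) l).+1 => m' Mm'; exists t; split=> // l lt.
  rewrite tm //=; apply: leq_trans Mm'; rewrite ltnS.
  exact: (@leq_bigmax_seq _ _ (fun=> true) id).
have [|t Ht] := @choice _ _ (fun j t => [/\ uniq t, forall l, l \in t -> (mm j <= l < mm j.+1)%N,
    forall l, l \in t -> abspow p (z (k j) i) l <= c / 4 / (mm j).+1%:R &
    c / 2 + c / 4 / (mm j).+1%:R * (mm j)%:R <= rsum (w i) (abspow p (z (k j) i)) 0 t]).
  by move=> j; have [[t h] _] := off j; exists t.
pose Sp := \sum_(j < N) `|a j| `^ p; pose D := Sp `^ p^-1.
have Sp0 : 0 <= Sp by apply: sumr_ge0 => j _; exact: powR_ge0.
have D0 : 0 <= D by exact: powR_ge0.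
have DSp : D `^ p = Sp by rewrite powRK.
have HD : lorentz_le (fun=> 1) p (trunc N a) D by apply: lp_le; rewrite ?DSp.
apply: (lorentz_leW p1 _ HD).
have down := blocks_down p1 Hw (fun j => (off j).2) (spread_lower p1 Hw Hz HK a i N0 Nk kk).
have err := error_sum_le (ltW r20) (fun j => trunc_abs p1 (weight_const1 R) HD) D0.
have [|||||||s us Hs] := lower_lp (Hw i) (p := p) (N := N) (a := a)
  (b := fun l => \sum_(j < N) a j * blocks z k mm i j l) (y := fun j => z (k j) i) (t := t)
  (lo := mm) (hi := fun j => mm j.+1) (B := fun j => c / 4 / (mm j).+1%:R) (k := c / 2).
- by move=> j _; have [] := Ht j.
- by move=> j l _; have [_ h _ _] := Ht j; exact: h.
- by move=> j j' /andP[jj' _]; exact: mm_sep.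
- move=> j l jN lt; have [_ h _ _] := Ht j.
  by rewrite (blocks_sumE z k a mmS i jN (h l lt)) normrM.
- by move=> j _; rewrite !divr_ge0 // ltW.
- by move=> j l _; have [_ _ h _] := Ht j; exact: h.
- by move=> j _; have [_ _ _ h] := Ht j.
have := le_trans Hs (down.2 s us).
have rp : r `^ p = c / 2 by rewrite powRK // ltW.
rewrite -/Sp -DSp -rp -powRM ?(ltW r0) // => /(powR_le_inv p0) h.
have {}h : r * D <= K * T + D * (r / 2).
  apply: (le_trans (h _ _)); [by rewrite mulr_ge0 // ltW|exact: down.1|].
  by rewrite lerD2l.
by rewrite mulrAC ler_pdivlMr //; lra.
Qed.

Section NoFlatParts.
Hypothesis sub : forall i N M, wsum (w i) (N * M) <= wsum (w i) N * wsum (w i) M.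
Hypothesis nonflat : forall i, ~ has_flat_parts i.

(** The bound is inherited by smaller [tau], so it holds for all [tau] near 0 on the right, and the
    finitely many coordinates can be intersected. *)
Lemma nonflat_uniform (c : R) : 0 < c -> exists2 tau, 0 < tau &
  \forall k \near \oo, forall i t, uniq t -> (forall l, l \in t -> `|z k i l| <= tau) ->
    rsum (w i) (abspow p (z k i)) 0 t <= c.
Proof.
move=> c0.
have H (i : 'I_n) : \forall tau \near 0^'+, \forall k \near \oo, forall t, uniq t ->
    (forall l, l \in t -> `|z k i l| <= tau) -> rsum (w i) (abspow p (z k i)) 0 t <= c.
  have [tau tau0 [L HL]] : exists2 tau, 0 < tau & exists L, forall k, (L <= k)%N ->
      forall t, uniq t -> (forall l, l \in t -> `|z k i l| <= tau) ->
      rsum (w i) (abspow p (z k i)) 0 t <= c.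
    apply: contrapT => H; apply: (nonflat (i := i)); exists c => // tau tau0 L.
    apply: contrapT => H'; apply: H; exists tau => //; exists L => k Lk t ut tt.
    rewrite leNgt; apply/negP => ct; apply: H'; exists k => //; exists t; split=> //.
    exact: ltW.
  near=> u; exists L => // k Lk t ut tt; apply: HL => // l /tt/le_trans; apply.
  by near: u; exact: nbhs_right_le.
have {}H : \forall tau \near 0^'+, forall i : 'I_n, \forall k \near \oo, forall t, uniq t ->
    (forall l, l \in t -> `|z k i l| <= tau) -> rsum (w i) (abspow p (z k i)) 0 t <= c.
  exact: filter_forall.
have [tau [Htau tau0]] := filter_ex (filterI H (nbhs_right_gt (0 : R))).
by exists tau => //; exact: filter_forall.
Unshelve. all: by end_near. Qed.

Lemma nopeak_small (i : 'I_n) (e : R) : ~ has_peaks z i -> 0 < e ->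
  \forall k \near \oo, lorentz_le (w i) p (z k i) e.
Proof.
move=> np e0; have [tau tau0 Htau] := nonflat_uniform (powR_gt0 p e0).
have [L HL] : exists L, forall k, (L <= k)%N -> forall l, `|z k i l| <= tau.
  apply: contrapT => H; apply: np; exists tau => // L.
  apply: contrapT => H'; apply: H; exists L => k Lk l; rewrite leNgt; apply/negP => tl.
  by apply: H'; exists k => //; exists l.
have [L' _ HL'] := Htau; exists (maxn L L') => // k Lk; split; first exact: ltW.
move=> s us; apply: (HL' k (leq_trans (leq_maxr _ _) Lk)) => // l _.
exact: HL (leq_trans (leq_maxl _ _) Lk) l.
Qed.

(** Otherwise all coordinates of a late term have norm at most 1/2, against normalization. *)
Lemma ex_peaks : exists i, has_peaks z i.
Proof.
apply: contrapT => H.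
have e0 : 0 < 2^-1 :> R by rewrite invr_gt0.
have : \forall k \near \oo, forall i : 'I_n, lorentz_le (w i) p (z k i) 2^-1.
  by apply: filter_forall => i; apply: nopeak_small => // pk; apply: H; exists i.
move=> [L _ /(_ L (leqnn L)) HL].
have : normX w p (z L) <= 2^-1 by apply: X_le_norm => //; split=> //; exact: ltW.
by rewrite (Hz L).2; lra.
Qed.

Lemma pigeonhole (F : finType) (f : nat -> F) :
  exists v, forall L, exists2 k, (L <= k)%N & f k = v.
Proof.
apply: contrapT => H.
have : \forall k \near \oo, forall v, f k != v.
  apply: filter_forall => v.
  have [L HL] : exists L, forall k, (L <= k)%N -> f k != v.
    apply: contrapT => H'; apply: H; exists v => L; apply: contrapT => H''.
    apply: H'; exists L => k Lk; apply/negP => /eqP fk; apply: H''.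
    by exists k.
  by exists L.
by move=> [L _ /(_ L (leqnn L))/(_ (f L))]; rewrite eqxx.
Qed.

Lemma ex_dyadic (tau : R) : 0 < tau -> exists G, 1 <= dyadic tau G.
Proof.
move=> tau0; have [G _ HG] : \forall G \near \oo, tau^-1 <= G%:R by exact: nbhs_infty_ger.
exists G; rewrite /dyadic -ler_pdivrMl // mulr1; apply: (le_trans (HG G (leqnn G))).
by rewrite -natrX ler_nat ltnW // ltn_expl.
Qed.

(** The constant 4 is made of 2 for dyadic rounding, 1 for the entries up to [tau], and 1 for the
    parts off the blocks. Coordinates without peaks have late terms of norm at most [e] and fit into
    the same bound. *)
Lemma peaks_upper N (a : nat -> R) D :
  (forall i, has_peaks z i -> lorentz_le (w i) p (trunc N a) D) ->
  `| \sum_(i < N) a i *: zt i | <= K * 4 * D.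
Proof.
move=> Ha; have [i0 pk0] := ex_peaks; have Ha0 := Ha i0 pk0; have D0 := Ha0.1.
have [->|N0] := posnP N.
  by rewrite big_ord0 normr0 !mulr_ge0.
have aD j : (j < N)%N -> `|a j| <= D by exact: trunc_abs Ha0.
have e0 : 0 < 1 / N.+1%:R :> R by rewrite divr_gt0.
set e := 1 / N.+1%:R in e0.
have err := error_sum_le ler01 aD D0; rewrite -/e mulr1 in err.
have [tau tau0 Htau] := nonflat_uniform (powR_gt0 p e0).
have [G HG] := ex_dyadic tau0.
have [|q Hq] := @choice _ _ (fun (i : 'I_n) q => forall b s, lorentz_le (w i) p b 1 ->
    uniq s -> (forall m, m \in s -> tau < `|b m|) -> (size s < q)%N).
  by move=> i; exact: level_bound.
have [|E HE] := @choice _ _ (fun (kig : nat * 'I_n * nat) s => uniq s /\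
    forall m, (m \in s) = (dyadic tau kig.2 < `|z kig.1.1 kig.1.2 m|)).
  move=> [[k i] g]; have [s us Hs] := level_list p1 (Hw i) (@unb i)
    ((normalized_le p1 Hw Hz k).2 i) (dyadic_gt0 tau0 g).
  by exists s.
pose Q := \max_i q i.
have EQ k i g : (size (E (k, i, g)) < Q.+1)%N.
  have [us Hs] := HE (k, i, g); rewrite ltnS; apply: leq_trans (leq_bigmax i).
  apply: ltnW; apply: (Hq i (z k i)) => //; first exact: (normalized_le p1 Hw Hz k).2.
  move=> m; rewrite Hs /=; apply: le_lt_trans.
  by have := dyadic_le tau0 (leq0n g); rewrite {1}/dyadic expr0 mulr1.
(* The numbers of entries above each level in each coordinate are bounded for all terms, so together
   they form a point of a finite type, and some value recurs infinitely often. *)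
pose f k := [ffun ig : 'I_n * 'I_G => Ordinal (EQ k ig.1 ig.2)].
have [v Hv] := pigeonhole f.
have nosmall : \forall k \near \oo, forall i : 'I_n, ~ has_peaks z i -> lorentz_le (w i) p (z k i) e.
  apply: filter_forall => i; have [pk|np] := pselect (has_peaks z i); first by exists 0%N.
  by have := nopeak_small np e0; apply: filterS.
pose P k := (forall i t, uniq t -> (forall l, l \in t -> `|z k i l| <= tau) ->
    rsum (w i) (abspow p (z k i)) 0 t <= e `^ p) /\
  (forall i : 'I_n, ~ has_peaks z i -> lorentz_le (w i) p (z k i) e).
have [L0 _ HL0] : \forall k \near \oo, P k by exact: filterI.
have [|k [mm [Nk kk mmS off]]] := gliding_hump p1 Hw Hz unb null
  (Q := fun _ k _ => f k = v /\ P k) N e0.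
  move=> m L; have [k Lk fk] := Hv (maxn L L0); exists k; first exact: leq_trans (leq_maxl _ _) Lk.
  by exists 0%N => m' _; split=> //; apply: HL0; exact: leq_trans (leq_maxr _ _) Lk.
rewrite -mulrA; apply: (spread_upper p1 Hw K0 HK N0 Nk kk); split=> [|i]; first by rewrite mulr_ge0.
have [pk|np] := pselect (has_peaks z i); last first.
  have : lorentz_le (w i) p (vcomb N a k z i) (\sum_(j < N) `|a j| * e).
    apply: (lorentz_le_sum p1 (Hw i) (F := fun j m => a j * z (k j) i m) (A := fun j => `|a j| * e)).
    move=> j _; apply: lorentz_leZ => //; have [[_ [_ h]] _] := off j; exact: h.
  by apply: lorentz_leW => //; lra.
(* What remains after splitting off the small entries lies between [tau] and [dyadic tau G], the
   range in which rounding is accurate. *)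
pose big j l := if tau < `|blocks z k mm i j l| then blocks z k mm i j l else 0.
pose small j l := if tau < `|blocks z k mm i j l| then 0 else blocks z k mm i j l.
have Hsmall j : lorentz_le (w i) p (small j) e.
  have [[_ [h _]] _] := off j; split=> [|s us]; first exact: ltW.
  pose s' := seq.filter (fun l => `|z (k j) i l| <= tau) s.
  have sz l : ~~ (`|z (k j) i l| <= tau) -> small j l = 0.
    rewrite -ltNge /small /blocks /block => tz.
    by case: (mm j <= l < mm j.+1)%N; rewrite ?tz ?if_same.
  apply: (@le_trans _ _ (rsum (w i) (abspow p (small j)) 0 s')).
    apply: rsum_filter => // [l|l _ /sz]; first exact: abspow_ge0.
    by rewrite /abspow => ->; rewrite normr0 powR0 // gt_eqF.
  apply: (@le_trans _ _ (rsum (w i) (abspow p (z (k j) i)) 0 s')).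
    apply: rsum_le => // l _; apply: powR_le_abs => //.
    rewrite /small; case: ifP => _; first by rewrite normr0.
    exact: block_le.
  apply: h; first exact: filter_uniq.
  by move=> l; rewrite mem_filter => /andP[].
have bigsupp j l : big j l != 0 -> big j l = blocks z k mm i j l /\ tau < `|blocks z k mm i j l|.
  by rewrite /big; case: ifP => //; rewrite eqxx.
have dis : disjoint_upto N big.
  move=> j j' l jN j'N /[dup] h /bigsupp[E1 _] /[dup] h' /bigsupp[E2 _].
  have d : disjoint_upto N (blocks z k mm i) by exact: blocks_disjoint.
  by apply: (d j j' l) => //; [rewrite -E1|rewrite -E2].
(* All selected terms share the level counts of the term [k 0], so these counts serve every
   block. *)
pose c g := size (E (k 0%N, i, g)).
have layers : \sum_(g < G) dyadic_step p tau g * wsum (w i) (c g) <= 2 `^ p.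
  have := @dyadic_layers _ _ p1 _ (Hw i) _ tau0 _ _ G (fun g => E (k 0%N, i, g))
    ((normalized_le p1 Hw Hz (k 0%N)).2 i).
  rewrite mulr1; apply=> g; first by have [] := HE (k 0%N, i, g).
  by move=> m; have [_ ->] := HE (k 0%N, i, g).
have Hbig : lorentz_le (w i) p (fun l => \sum_(j < N) a j * big j l) (2 * D).
  apply: (tensor_upper p1 (Hw i) (@sub i) tau0 (G := G) (c := c)) => //.
  - move=> j l jN /bigsupp[-> ->] /=; apply: le_trans HG.
    exact: (lorentz_le_abs l (Hw i) p0 (blocks_le1 p1 Hw Hz k mm i j)).
  - move=> j g jN gG; exists (E (k j, i, g)).
      have [[fj _] _] := off j; have [[f0 _] _] := off 0%N.
      have := congr1 (fun h : {ffun 'I_n * 'I_G -> 'I_Q.+1} => h (i, Ordinal gG) : nat) (etrans fj (esym f0)).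
      by rewrite /f !ffunE /= => ->.
    move=> l; have [_ ->] := HE (k j, i, g) => /lt_le_trans; apply.
    apply: (@le_trans _ _ `|blocks z k mm i j l|); last exact: block_le.
    by rewrite /big; case: ifP => // _; rewrite normr0.
  - exact: Ha.
have Hs := lorentz_le_sum p1 (Hw i) (N := N) (F := fun j l => a j * small j l)
  (A := fun j => `|a j| * e) (fun j _ => lorentz_leZ (Hw i) (a j) (Hsmall j)).
have : lorentz_le (w i) p (fun l => \sum_(j < N) a j * blocks z k mm i j l) (3 * D).
  apply: (lorentz_leW p1 (C := 2 * D + \sum_(j < N) `|a j| * e)); first lra.
  apply: lorentz_le_mono (lorentz_leD p1 (Hw i) Hbig Hs) => // l.
  rewrite -big_split /= le_eqVlt; apply/orP; left; apply/eqP; congr `|_|.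
  apply: eq_bigr => j _; rewrite -mulrDr /big /small.
  by case: ifP; rewrite ?addr0 ?add0r.
move=> /(blocks_up p1 Hw (fun j => (off j).2)); apply: lorentz_leW => //; lra.
Qed.

End NoFlatParts.

End UpperLowerEstimates.

(** * Weights of submultiplicative functions *)

Section WeightOf.
Variables (R : realType) (S : R -> R).
Hypothesis HS : submultiplicative S.

Let S1 : S 1 = 1. Proof. by have [_ _ _ -> //] := HS; rewrite lexx ler1n. Qed.

(** Concavity at the midpoint of two integers at distance 2 makes the increments decrease; the first
    comparison is an equality, [S] being the identity on [1,2]. *)
Lemma weight_of_weight : weight (weight_of S).
Proof.
have [_ inc conc id12 _] := HS; split=> //= -[|k] //=.
- by rewrite subr_ge0 ltW // inc ?ler1n // ltr_nat.
- by rewrite !id12 ?lexx ?ler1n //; lra.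
have h0 : (0 : R) <= 2^-1 by rewrite invr_ge0.
have h1 : (2^-1 : R) <= 1 by rewrite invf_le1 // ler1n.
have := conc k.+1%:R k.+3%:R 2^-1; rewrite !ler1n => /(_ isT isT).
have -> : 2^-1 * k.+1%:R + (1 - 2^-1) * k.+3%:R = k.+2%:R :> R.
  by rewrite -[k.+3]addn2 -[k.+2]addn1 !natrD; field.
by rewrite h0 h1 => /(_ isT) /=; lra.
Qed.

Lemma wsum_weight_of N : wsum (weight_of S) N.+1 = S N.+1%:R.
Proof.
elim: N => [|N IH]; first by rewrite wsumS wsum0 add0r S1.
by rewrite wsumS IH /= addrC subrK.
Qed.

Lemma wsum_weight_of_mul N M :
  wsum (weight_of S) (N * M) <= wsum (weight_of S) N * wsum (weight_of S) M.
Proof.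
have [_ _ _ _ mul] := HS.
case: N => [|N]; first by rewrite mul0n wsum0 mul0r.
case: M => [|M]; first by rewrite muln0 wsum0 mulr0.
rewrite -[(_ * _)%N]prednK ?muln_gt0 // !wsum_weight_of prednK ?muln_gt0 //.
by rewrite natrM mul ?ler1n.
Qed.

End WeightOf.

(** * Polynomials as finitely supported sequences *)

Section NormedPoly.
Variable R : realType.

(** Bundling a norm with its laws allows an alias of the polynomials, indexed by the norm, to carry
    a normed module structure for each norm. *)
Record poly_norm := PolyNorm {
  pnorm : {poly R} -> R;
  pnormD : forall x y, pnorm (x + y) <= pnorm x + pnorm y;
  pnormZ : forall (l : R) x, pnorm (l *: x) = `|l| * pnorm x;
  pnorm0 : forall x, pnorm x = 0 -> x = 0 }.

Definition normed_poly (N : poly_norm) : Type := {poly R}.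

HB.instance Definition _ N := GRing.Lmodule.copy (normed_poly N) {poly R}.
HB.instance Definition _ N := @Lmodule_isNormed.Build R (normed_poly N)
  (pnorm N) (@pnormD N) (@pnormZ N) (@pnorm0 N).

End NormedPoly.

#[local] Opaque normX.

(** * Model spaces and disjoint sequences *)

Section ModelSpace.
Variables (R : realType) (p : R) (n : nat) (w : nat -> nat -> R).
Hypothesis p1 : 1 <= p.
Hypothesis Hw : forall i, weight (w i).
Variable A : {set 'I_n}.
Variable i0 : 'I_n.
Hypothesis Ai0 : i0 \in A.

Let p0 : 0 < p. Proof. exact: lt_le_trans p1. Qed.

Definition spread_on (f : nat -> R) : 'I_n -> nat -> R :=
  fun i m => if i \in A then f m else 0.

Lemma spread_on_le f C : 0 <= C -> X_le p w (spread_on f) C <->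
  forall i, i \in A -> lorentz_le (w i) p f C.
Proof.
move=> C0; rewrite /spread_on; split=> [[_ H] i iA|H].
  by have := H i; rewrite iA.
by split=> // i; have [/H//|_] := boolP (i \in A); exact: lorentz_le0.
Qed.

Lemma in_X_poly (q : {poly R}) : in_X w p (spread_on (nth 0 q)).
Proof.
move=> i; have [C HC] := trunc_lorentz p1 (size q) (nth 0 q) (Hw i).
apply: (lorentz_le_in (Hw i) p0 (C := C)); apply: lorentz_le_mono HC => // m.
rewrite /spread_on /trunc; case: ifP => _; last by rewrite normr0.
by case: ltnP => // h; rewrite nth_default.
Qed.

Let nrm (q : {poly R}) : R := normX w p (spread_on (nth 0 q)).

Let nrmD x y : nrm (x + y) <= nrm x + nrm y.
Proof.
apply: le_trans (normXD p1 Hw (in_X_poly x) (in_X_poly y)).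
rewrite /nrm (_ : spread_on _ = vadd (spread_on (nth 0 x)) (spread_on (nth 0 y))) //.
apply/funext => i; apply/funext => m; rewrite /vadd /spread_on.
by case: ifP => _; rewrite ?coefD ?addr0.
Qed.

Let nrmZ (l : R) x : nrm (l *: x) = `|l| * nrm x.
Proof.
rewrite -(normXZ p1 Hw l (in_X_poly x)) /nrm.
rewrite (_ : spread_on (nth 0 (l *: x)) = vscale l (spread_on (nth 0 x))) //.
apply/funext => i; apply/funext => m; rewrite /vscale /spread_on.
by case: ifP => _; rewrite ?coefZ ?mulr0.
Qed.

Let nrm0 x : nrm x = 0 -> x = 0.
Proof.
move=> x0; apply/polyP => m; rewrite coef0; apply/eqP; rewrite -normr_le0.
have := X_le_abs p1 Hw i0 m (normX_le p1 Hw (in_X_poly x)).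
by rewrite -/(nrm x) x0 /spread_on Ai0.
Qed.

(** The polynomials with the norm of their copies in the coordinates of [A]; ['X^j] is the j-th unit
    vector, and the element [i0] of [A] makes the norm definite. The two statements say that the
    norm is the maximum of the Lorentz norms over [A]. *)
Lemma ex_model_space : exists (Y : normedModType R) (yt : nat -> Y), forall N (a : nat -> R),
  (forall i, i \in A -> lorentz_le (w i) p (trunc N a) `| \sum_(j < N) a j *: yt j |) /\
  (forall D, 0 <= D -> (forall i, i \in A -> lorentz_le (w i) p (trunc N a) D) ->
     `| \sum_(j < N) a j *: yt j | <= D).
Proof.
pose PN := PolyNorm nrmD nrmZ nrm0.
exists (normed_poly PN : normedModType R), (fun j => 'X^j : {poly R}) => N a.
have E : `| \sum_(j < N) a j *: ('X^j : normed_poly PN) | =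
    normX w p (spread_on (trunc N a)).
  rewrite -[LHS]/(nrm (\sum_(j < N) a j *: 'X^j)) -poly_def /nrm.
  rewrite (_ : spread_on _ = spread_on (trunc N a)) //.
  apply/funext => i; apply/funext => m; rewrite /spread_on /trunc.
  by case: ifP => // _; rewrite coef_poly.
have inX : in_X w p (spread_on (trunc N a)).
  rewrite (_ : spread_on _ = spread_on (nth 0 (\poly_(j < N) a j))).
    exact: in_X_poly.
  by apply/funext => i; apply/funext => m; rewrite /spread_on coef_poly.
rewrite E; split; first by apply/(spread_on_le _ (normX_ge0 _ _ _)); exact: normX_le.
by move=> D D0 H; exact: (X_le_norm p1 Hw ((spread_on_le _ D0).2 H)).
Qed.

Section DisjointSequence.
Variable z : nat -> nat -> R.
Hypothesis disj : forall N, disjoint_upto N z.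
Hypothesis zle : forall i k, i \in A -> lorentz_le (w i) p (z k) 1.
Hypothesis zge : forall k, exists2 s, uniq s & 1 <= rsum (w i0) (abspow p (z k)) 0 s.
Variable pt : nat -> nat.
Hypothesis zpt : forall k, z k (pt k) != 0.

Let x k := spread_on (z k).

Lemma disjoint_normalized : normalized w p x.
Proof.
move=> k; have Hx : X_le p w (x k) 1.
  by apply/spread_on_le => // i iA; exact: zle.
have inX := X_le_in p1 Hw Hx; split=> //; apply/eqP; rewrite eq_le (X_le_norm p1 Hw Hx) /=.
have [_ /(_ i0)[h0 h]] := normX_le p1 Hw inX; have [s us hs] := zge k.
apply: (powR_le_inv p0) => //; rewrite powR1.
apply: (le_trans hs); apply: le_trans (h s us).
by apply: rsum_le => // m _; rewrite /abspow /x /spread_on Ai0.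
Qed.

Lemma sum_disjoint N (b : nat -> R) k m : z k m != 0 ->
  \sum_(j < N) b j * z j m = if (k < N)%N then b k * z k m else 0.
Proof.
move=> zk.
have H j : j != k -> z j m = 0.
  move=> jk; apply: contrapT => /eqP zj; move/eqP: jk; apply.
  by apply: (disj (N := (maxn j k).+1)) zj zk; rewrite ltnS ?leq_maxl ?leq_maxr.
case: ifP => kN.
  rewrite (bigD1 (Ordinal kN)) //= big1 ?addr0 // => j; rewrite -val_eqE /= => /H->.
  by rewrite mulr0.
rewrite big1 // => j _; rewrite H ?mulr0 //.
by apply/eqP => jk; move: kN; rewrite -jk ltn_ord.
Qed.

Lemma vcomb_disjoint N (b : nat -> R) i m :
  vcomb N b id x i m = if i \in A then \sum_(j < N) b j * z j m else 0.
Proof.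
rewrite /vcomb /x /spread_on; case: ifP => // _.
by rewrite big1 // => j _; rewrite mulr0.
Qed.

Let diff y N b := vadd y (vscale (-1) (vcomb N b id x)).

Let diffE y N b i m : diff y N b i m =
  y i m - (if i \in A then \sum_(j < N) b j * z j m else 0).
Proof. by rewrite /diff /vadd /vscale vcomb_disjoint mulN1r. Qed.

Let in_diff y N b : in_X w p y -> in_X w p (diff y N b).
Proof.
move=> hy; exact: (in_X_D p1 Hw hy (in_X_Z p1 Hw (-1)
  (in_X_vcomb p1 Hw disjoint_normalized N b id))).
Qed.

Let diff_abs y N b i m : in_X w p y -> `|diff y N b i m| <= normX w p (diff y N b).
Proof. by move=> hy; exact: (X_le_abs p1 Hw i m (normX_le p1 Hw (in_diff N b hy))). Qed.

(** On the support of [z k] every combination is a multiple of [z k], and proportionality survives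
    limits; the factor is read off at the reference place [pt k]. *)
Lemma closed_span_coef y k m i : in_closed_span w p x y -> i \in A -> z k m != 0 ->
  y i m = y i0 (pt k) / z k (pt k) * z k m.
Proof.
move=> [hy span] iA zk; apply/eqP; rewrite -subr_eq0 -normr_le0; apply/ler_addgt0Pl => e e0.
(* [c] collects the error at [m] and the error at [pt k], the latter scaled by the ratio of the two
   entries of [z k]. *)
rewrite addr0; pose c := 1 + `|z k m| / `|z k (pt k)|.
have c0 : 0 < c by rewrite ltr_pwDl // divr_ge0.
have [N [b Hb]] := span (e / c) (divr_gt0 e0 c0).
pose beta := if (k < N)%N then b k else 0.
have h l i' : i' \in A -> z k l != 0 -> `|y i' l - beta * z k l| <= e / c.
  move=> iA' zl; apply: le_trans (ltW Hb); have := diff_abs N b i' l hy; rewrite diffE iA'.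
  by rewrite (sum_disjoint N b zl) /beta; case: ifP => // _; rewrite mul0r.
have h1 := h m i iA zk; have h2 := h (pt k) i0 Ai0 (zpt k).
have -> : y i m - y i0 (pt k) / z k (pt k) * z k m =
    (y i m - beta * z k m) - (y i0 (pt k) - beta * z k (pt k)) * (z k m / z k (pt k)).
  by field; exact: zpt.
apply: (le_trans (ler_normB _ _)); rewrite normrM normf_div.
apply: (@le_trans _ _ (e / c + e / c * (`|z k m| / `|z k (pt k)|))).
  by apply: lerD => //; rewrite ler_wpM2r // divr_ge0.
by rewrite -{1}[e / c]mulr1 -mulrDr -/c divfK // gt_eqF.
Qed.

(** With the coefficients read off at the places [pt k], the remainder vanishes on the supports
    already used and equals [y] elsewhere. It is thus dominated, entry by entry, by the remainder of
    any approximant with no more terms. *)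
Lemma disjoint_basic : basic_seq w p x.
Proof.
have nn u : `|0 - normX w p u| = normX w p u.
  by rewrite sub0r normrN ger0_norm // normX_ge0.
move=> y Hy; have [hy span] := Hy.
pose a k := y i0 (pt k) / z k (pt k); exists a; split.
  apply/cvgrPdist_le => e e0; have [N [b Hb]] := span e e0; exists N => // M NM /=.
  rewrite nn; apply: le_trans (ltW Hb).
  apply: (X_le_norm p1 Hw); have [h0 h] := normX_le p1 Hw (in_diff N b hy).
  split=> // i; apply: lorentz_le_mono (h i) => // m; rewrite -/(diff y M a) !diffE.
  case: ifP => // iA.
  have [[k zk]|no] := pselect (exists k, z k m != 0).
    rewrite !(sum_disjoint _ _ zk) (closed_span_coef Hy iA zk).
    case: ifP => kM; first by rewrite subrr normr0.
    by rewrite ifF //; apply: contraFF kM => /leq_trans; apply.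
  have z0 j : z j m = 0 by apply: contrapT => /eqP zj; apply: no; exists j.
  by rewrite !big1 // => j _; rewrite z0 mulr0.
move=> a' Ha'; apply/funext => k; rewrite /a.
apply/eqP; rewrite -subr_eq0 -normr_le0; apply/ler_addgt0Pl => e e0; rewrite addr0.
have zk0 : 0 < `|z k (pt k)| by rewrite normr_gt0.
have /cvgrPdist_le/(_ _ (mulr_gt0 e0 zk0))[M _ HM] := Ha'.
have := HM (maxn M k.+1) (leq_maxl _ _); rewrite /= nn.
have := diff_abs (maxn M k.+1) a' i0 (pt k) hy.
rewrite diffE Ai0 (sum_disjoint _ _ (zpt k)) leq_maxr => /le_trans h /h.
have -> : y i0 (pt k) - a' k * z k (pt k) = (y i0 (pt k) / z k (pt k) - a' k) * z k (pt k).
  by field; exact: zpt.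
by rewrite normrM ler_pM2r.
Qed.

Lemma functional_vcomb f N (a : nat -> R) k : bounded_linear_functional w p f ->
  f (vcomb N a k x) = \sum_(j < N) a j * f (x (k j)).
Proof.
move=> [lin _].
have h0 : X_le p w (@vzero R n) 0 by exact: X_le0.
have in0 := X_le_in p1 Hw h0.
elim: N => [|N IH].
  have -> : vcomb 0 a k x = @vzero R n.
    by apply/funext => i; apply/funext => m; rewrite /vcomb big_ord0.
  have := lin (-1) _ _ in0 in0.
  have -> : vadd (vscale (-1) (@vzero R n)) (@vzero R n) = @vzero R n.
    by apply/funext => i; apply/funext => m; rewrite /vadd /vscale /vzero mulr0 addr0.
  by rewrite mulN1r addNr big_ord0.
rewrite big_ord_recr /= -IH addrC -lin.
- congr f; apply/funext => i; apply/funext => m.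
  by rewrite /vadd /vscale /vcomb big_ord_recr /= addrC.
- exact: (disjoint_normalized (k N)).1.
- exact: (in_X_vcomb p1 Hw disjoint_normalized N a k).
Qed.

Lemma disjoint_vcomb_le N a k D : (forall i j, (i < j < N)%N -> (k i < k j)%N) ->
  lorentz_le (fun=> 1) p (trunc N a) D -> X_le p w (vcomb N a k x) D.
Proof.
move=> kk Ha; have -> : vcomb N a k x = spread_on (fun m => \sum_(j < N) a j * z (k j) m).
  apply/funext => i; apply/funext => m; rewrite /vcomb /x /spread_on; case: ifP => // _.
  by rewrite big1 // => j _; rewrite mulr0.
apply/spread_on_le; first exact: Ha.1.
move=> i iA; rewrite -[D]mulr1.
apply: (disjoint_upper_lp p1 (Hw i) _ ler01 (fun j _ => zle (k j) iA) Ha).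
move=> j j' m jN j'N zj zj'.
have : k j = k j' by apply: (disj (N := (maxn (k j) (k j')).+1)) zj zj'; rewrite ltnS ?leq_maxl ?leq_maxr.
case: (ltngtP j j') => // jj' kE.
  by have := kk j j'; rewrite jj' j'N kE ltnn => /(_ isT).
by have := kk j' j; rewrite jj' jN kE ltnn => /(_ isT).
Qed.

(** If [|f|] exceeded [e] on infinitely many terms, a signed sum of [N] of them would have [f]-value
    at least [N e] and norm at most [N^(1/p)], which is absurd for large [N] as [p > 1]. *)
Lemma disjoint_weakly_null : 1 < p -> weakly_null w p x.
Proof.
move=> p_gt1 f Hf; apply/cvgrPdist_le => e e0; apply: contrapT => H.
have [|g Hg] := @choice _ _ (fun L k => (L <= k)%N /\ e < `|f (x k)|).
  move=> L; apply: contrapT => HL; apply: H; exists L => // k Lk /=.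
  rewrite sub0r normrN leNgt; apply/negP => ek; apply: HL; by exists k.
pose k := fix k j := if j is j'.+1 then g (k j').+1 else g 0%N.
have kk : {homo k : i j / (i < j)%N}.
  apply: homo_ltn => [? ? ?|j]; first exact: ltn_trans.
  by have [] := Hg (k j).+1.
have ek j : e < `|f (x (k j))| by case: j => [|j] /=; [have [] := Hg 0%N|have [] := Hg (k j).+1].
pose a j := Num.sg (f (x (k j))).
have [_ [C HC]] := Hf.
have key N : (0 < N)%N -> N%:R * e <= `|C| * N%:R `^ p^-1.
  move=> N0; have HD : lorentz_le (fun=> 1) p (trunc N a) (N%:R `^ p^-1).
    apply: lp_le; rewrite ?powR_ge0 // powRK //.
    apply: (@le_trans _ _ (\sum_(j < N) 1)); last by rewrite sumr_const card_ord.
    apply: ler_sum => j _; have : `|a j| <= 1 by rewrite /a normr_sg lern1 leq_b1.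
    by move=> /(powR_le_abs p0 (normr_ge0 _)); rewrite powR1.
  have hX := disjoint_vcomb_le (fun i j => fun h => kk i j (andP h).1) HD.
  apply: (@le_trans _ _ `|f (vcomb N a k x)|).
    rewrite (functional_vcomb N a k Hf) ger0_norm; last first.
      by apply: sumr_ge0 => j _; rewrite /a -normrEsg.
    rewrite mulr_natl -[N in leLHS]card_ord -sumr_const; apply: ler_sum => j _.
    by rewrite /a -normrEsg ltW.
  apply: (le_trans (HC _ (X_le_in p1 Hw hX))).
  apply: (le_trans (ler_wpM2r (normX_ge0 _ _ _) (ler_norm C))).
  by rewrite ler_wpM2l // (X_le_norm p1 Hw hX).
pose q := 1 - p^-1.
have q0 : 0 < q by rewrite subr_gt0 invf_lt1.
(* [key] says that [N^q] is at most [|C| / e], which fails from this size on. *)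
pose M := (`|C| / e + 1) `^ q^-1.
have [N _ HN] : \forall N \near \oo, M <= N%:R by exact: nbhs_infty_ger.
have M0 : 0 <= `|C| / e by rewrite divr_ge0 // ltW.
have {}HN := HN N.+1 (leqnSn N).
have := key N.+1 isT; set r : R := N.+1%:R in HN *.
have r0 : 0 < r by rewrite ltr0n.
have -> : r * e = e * r `^ q * r `^ p^-1.
  by rewrite -mulrA -powRD ?subrK ?powRr1 ?(ltW r0) 1?mulrC // oner_eq0.
rewrite ler_pM2r ?powR_gt0 // leNgt => /negP; apply.
rewrite -ltr_pdivrMl // mulrC; apply: (@lt_le_trans _ _ (`|C| / e + 1)); first by rewrite ltrDl.
rewrite -[leLHS](powRK q0); first by apply: powR_le_abs => //; exact: powR_ge0.
by rewrite addr_ge0.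
Qed.

End DisjointSequence.

End ModelSpace.

(** * Realisation by unit vectors and by flat blocks *)

Section Examples.
Variables (R : realType) (p : R) (n : nat) (w : nat -> nat -> R).
Hypothesis p1 : 1 < p.
Hypothesis Hw : forall i, weight (w i).

Let p1' : 1 <= p. Proof. exact: ltW. Qed.
Let p0 : 0 < p. Proof. exact: lt_trans p1. Qed.

Lemma incr_upto N (k : nat -> nat) : (forall i, (i.+1 < N)%N -> (k i < k i.+1)%N) ->
  forall i j, (i < j < N)%N -> (k i < k j)%N.
Proof.
move=> H i; elim=> [//|j IH] /andP[]; rewrite ltnS leq_eqVlt => /orP[/eqP->|ij] jN.
  exact: H.
by apply: ltn_trans (H j jN); apply: IH; rewrite ij ltnW.
Qed.

Lemma incr_inj N (k : nat -> nat) : (forall i j, (i < j < N)%N -> (k i < k j)%N) ->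
  forall i j, (i < N)%N -> (j < N)%N -> k i = k j -> i = j.
Proof.
move=> H i j iN jN kij; case: (ltngtP i j) => // h.
  by have := H i j; rewrite h jN kij ltnn => /(_ isT).
by have := H j i; rewrite h iN kij ltnn => /(_ isT).
Qed.

Lemma lorentz_le_subsequence v N (a : nat -> R) (k : nat -> nat) C : weight v ->
  (forall i j, (i < j < N)%N -> (k i < k j)%N) ->
  lorentz_le v p (fun m => \sum_(j < N) a j * (m == k j)%:R) C <->
  lorentz_le v p (trunc N a) C.
Proof.
move=> Hv /incr_inj kinj; set b := fun m => _.
have bk j : (j < N)%N -> b (k j) = a j.
  move=> jN; rewrite /b (bigD1 (Ordinal jN)) //= eqxx mulr1 big1 ?addr0 //.
  move=> i; rewrite -val_eqE /= => ij; case: eqP => [/kinj h|]; rewrite ?mulr0 //.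
  by rewrite h ?eqxx ?ltn_ord in ij.
have b0 m : b m != 0 -> exists2 j, (j < N)%N & m = k j.
  move=> bm; apply: contrapT => H; move/eqP: bm; apply; rewrite /b big1 // => j _.
  by case: eqP => [mk|]; rewrite ?mulr0 //; case: H; exists j.
split=> H.
  apply: (lorentz_le_inj p1' Hv (g := k) H) => [j|j j'].
    by rewrite /trunc; case: ifP => [jN _|_]; rewrite ?eqxx // bk.
  rewrite /trunc; case: ltnP => jN; case: ltnP => j'N; rewrite ?eqxx // => _ _.
  exact: kinj.
pose g m := index m (map k (iota 0 N)).
have gP m : b m != 0 -> (g m < N)%N /\ k (g m) = m.
  move=> /b0[j jN ->]; have jm : k j \in map k (iota 0 N) by rewrite map_f // mem_iota.
  have gN : (g (k j) < N)%N by move: jm; rewrite -index_mem size_map size_iota.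
  split=> //; have := nth_index 0%N jm.
  by rewrite (nth_map 0%N) ?size_iota // nth_iota ?size_iota.
apply: (lorentz_le_inj p1' Hv (g := g) H) => [m /gP[gN gk]|m m' /gP[_ e] /gP[_ e'] gg]; last first.
  by rewrite -e -e' gg.
by rewrite -{1}gk bk // /trunc gN.
Qed.

(** The k-th vector repeats the k-th unit vector in each coordinate of [A]. Norms of combinations do
    not depend on the subsequence, so [eps] can be 0. *)
Lemma unit_vector_model (A : {set 'I_n}) (i0 : 'I_n) : i0 \in A ->
  exists (Y : normedModType R) (yt : nat -> Y), in_SPw n w p yt /\ forall N (a : nat -> R),
  (forall i, i \in A -> lorentz_le (w i) p (trunc N a) `| \sum_(j < N) a j *: yt j |) /\
  (forall D, 0 <= D -> (forall i, i \in A -> lorentz_le (w i) p (trunc N a) D) ->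
     `| \sum_(j < N) a j *: yt j | <= D).
Proof.
move=> Ai0; have [Y [yt HY]] := ex_model_space p1' Hw Ai0; exists Y, yt; split=> //.
pose z := fun k m : nat => (m == k)%:R : R.
have zpow k m : abspow p (z k) m = (m == k)%:R.
  by rewrite /abspow /z; case: eqP => _; rewrite ?normr1 ?normr0 ?powR1 // powR0 // gt_eqF.
have nz k m : z k m != 0 -> m = k.
  by apply: contraNeq => /negbTE mk; rewrite /z mk.
have disj N : disjoint_upto N z by move=> j j' m _ _ /nz <- /nz <-.
have zle (i : 'I_n) k : i \in A -> lorentz_le (w i) p (z k) 1.
  move=> _; split=> // s us; rewrite powR1.
  rewrite (eq_rsum (Hw i) (c' := fun m => (m == k)%:R)); last by move=> m _; exact: zpow.
  apply: (le_trans (rsum_indic (Hw i) (P := fun m => m == k) (e := [:: k]) us _)).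
    by move=> m _; rewrite inE.
  by rewrite wsumS wsum0 add0r (weight0 (Hw i)).
have zge k : exists2 s, uniq s & 1 <= rsum (w i0) (abspow p (z k)) 0 s.
  by exists [:: k] => //=; rewrite zpow eqxx (weight0 (Hw i0)) mulr1 addr0.
have zpt k : z k (id k) != 0 by rewrite /z eqxx oner_eq0.
have Hz := disjoint_normalized p1' Hw Ai0 zle zge.
exists (fun k => spread_on A (z k)); split.
- exact: Hz.
- exact: (disjoint_basic p1' Hw Ai0 disj zle zge zpt).
- exact: (disjoint_weakly_null p1' Hw Ai0 disj zle zge p1).
exists (fun=> 0); split=> //; first exact: cvg_cst.
move=> N a k _ N0 _ /incr_upto kk; rewrite addr0 invr1 !mul1r.
set V := vcomb N a k _.
have VE : V = spread_on A (fun m => \sum_(j < N) a j * (m == k j)%:R).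
  apply/funext => i; apply/funext => m; rewrite /V /vcomb /spread_on; case: ifP => // _.
  by rewrite big1 // => j _; rewrite mulr0.
have inV : in_X w p V := in_X_vcomb p1' Hw Hz N a k.
have [HD HD'] := HY N a; apply/andP; split.
  apply: HD' => [|i iA]; first exact: normX_ge0.
  apply/(lorentz_le_subsequence a _ (Hw i) kk).
  have := normX_le p1' Hw inV; rewrite {1}VE => /(spread_on_le p1' Hw _ _ (normX_ge0 _ _ _)).
  exact.
apply: (X_le_norm p1' Hw); rewrite VE; apply/(spread_on_le p1' Hw); first exact: normr_ge0.
by move=> i iA; apply/(lorentz_le_subsequence a _ (Hw i) kk); exact: HD.
Qed.

(** Normalized constant blocks in one coordinate, each so long that the ranks spent on all earlier
    ones hardly matter; their spreading model is l_p itself. *)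
Lemma flat_block_model (i0 : 'I_n) : (forall M, exists N, M < wsum (w i0) N) ->
  exists (Y : normedModType R) (yt : nat -> Y),
    in_SPw n w p yt /\ dominates_weight p yt (fun=> 1).
Proof.
move=> unb; pose A : {set 'I_n} := finset.set1 i0.
have Ai0 : i0 \in A by rewrite finset.in_set1.
have HA i : i \in A -> i = i0 by rewrite finset.in_set1 => /eqP.
(* One coordinate with constant weight 1: the model space is l_p. *)
have [Y [yt HY]] := @ex_model_space R p 1 (fun _ _ => 1) p1' (fun=> weight_const1 R)
  (finset.setTfor 'I_1) ord0 (finset.in_setT _).
exists Y, yt; split; last first.
  by exists 1 => // N a; rewrite mul1r; apply: (HY N a).1 (finset.in_setT (ord0 : 'I_1)).
have HY2 N a D : lorentz_le (fun=> 1) p (trunc N a) D -> `| \sum_(j < N) a j *: yt j | <= D.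
  by move=> h; apply: (HY N a).2 => //; exact: h.1.
have HY1 N a : lorentz_le (fun=> 1) p (trunc N a) `| \sum_(j < N) a j *: yt j |.
  exact: (HY N a).1 (finset.in_setT (ord0 : 'I_1)).
(* A block of weight sum [W k] has entries of p-th power [1 / W k], so this length makes a delay by
   [mm k] ranks cost at most [1 / (k + 3)]. *)
have [|len Hlen] := @choice _ _ (fun (km : nat * nat) N =>
    (km.1 + 3)%:R * km.2%:R + 1 < wsum (w i0) N).
  by move=> km; exact: unb.
pose mm := fix mm k := if k is k'.+1 then (mm k' + len (k', mm k'))%N else 0%N.
pose L k := len (k, mm k); pose W k := wsum (w i0) (L k).
have HW k : (k + 3)%:R * (mm k)%:R + 1 < W k by exact: (Hlen (k, mm k)).
have W0 k : 0 < W k by apply: le_lt_trans (HW k); rewrite addr_ge0 ?mulr_ge0.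
have mmS k : mm k.+1 = (mm k + L k)%N by [].
have L0 k : (0 < L k)%N.
  by case: posnP => // E; have := W0 k; rewrite /W E wsum0 ltxx.
have mm_lt k : (mm k < mm k.+1)%N by rewrite mmS -addn1 leq_add2l.
pose h k := (W k)^-1 `^ p^-1.
have h0 k : 0 < h k by rewrite powR_gt0 // invr_gt0.
have hp k : h k `^ p = (W k)^-1 by rewrite powRK // invr_ge0 ltW.
pose z := fun k m => if (mm k <= m < mm k.+1)%N then h k else 0.
have zpow k m : abspow p (z k) m = (W k)^-1 * (mm k <= m < mm k.+1)%N%:R.
  rewrite /abspow /z; case: ifP => _; first by rewrite mulr1 gtr0_norm.
  by rewrite mulr0 normr0 powR0 // gt_eqF.
have nz k m : z k m != 0 -> (mm k <= m < mm k.+1)%N.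
  by rewrite /z; case: ifP => //; rewrite eqxx.
have disj N : disjoint_upto N z.
  by move=> j j' m _ _ /nz h1 /nz h2; exact: mm_inj h1 h2.
have mem_blk k m : (m \in iota (mm k) (L k)) = (mm k <= m < mm k.+1)%N.
  by rewrite mem_iota mmS.
have zle (i : 'I_n) k : i \in A -> lorentz_le (w i) p (z k) 1.
  move=> /HA->; split=> // s us; rewrite powR1.
  rewrite (eq_rsum (Hw i0) (c' := fun m => (W k)^-1 * (mm k <= m < mm k.+1)%N%:R)); last first.
    by move=> m _; exact: zpow.
  rewrite rsumZ ler_pdivrMl // mulr1.
  apply: (le_trans (rsum_indic (Hw i0) (P := fun m => (mm k <= m < mm k.+1)%N)
    (e := iota (mm k) (L k)) us _)); last by rewrite size_iota.
  by move=> m _; rewrite mem_blk.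
have zsum k : 1 <= rsum (w i0) (abspow p (z k)) 0 (iota (mm k) (L k)).
  have := rsum_ge_level p1' (Hw i0) (a := z k) (ltW (h0 k)) (e := iota (mm k) (L k)).
  rewrite size_iota hp -/(W k) mulVf ?gt_eqF //; apply=> m; rewrite mem_blk /z => ->.
  by rewrite gtr0_norm.
have zge k : exists2 s, uniq s & 1 <= rsum (w i0) (abspow p (z k)) 0 s.
  by exists (iota (mm k) (L k)); rewrite ?iota_uniq.
have zpt k : z k (mm k) != 0 by rewrite /z leqnn mm_lt gt_eqF.
have Hz := disjoint_normalized p1' Hw Ai0 zle zge.
exists (fun k => spread_on A (z k)); split.
- exact: Hz.
- exact: (disjoint_basic p1' Hw Ai0 disj zle zge zpt).
- exact: (disjoint_weakly_null p1' Hw Ai0 disj zle zge p1).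
exists (fun N => N.+1%:R^-1); split=> //.
- by move=> N; rewrite lef_pV2 ?posrE // ler_nat.
- exact: cvg_harmonic.
move=> N a k _ N0 Nk /incr_upto kk.
set V := vcomb N a k _; set D := `| _ |.
have inV : in_X w p V := in_X_vcomb p1' Hw Hz N a k.
have D0 : 0 <= D by exact: normr_ge0.
have HD : X_le p w V D := disjoint_vcomb_le p1' Hw disj zle kk (HY1 N a).
have NV0 : 0 <= normX w p V by exact: normX_ge0.
apply/andP; split; last first.
  by apply: (le_trans (X_le_norm p1' Hw HD)); rewrite ler_peMl // lerDl.
(* [kap] is the inverse of [1 + eps N]. For [j < N] the index satisfies [k j + 3 >= N + 2], so each
   block keeps at least [kap] of its mass after the delay. *)
pose kap : R := 1 - N.+2%:R^-1.
have -> : (1 + N.+1%:R^-1)^-1 = kap.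
  have n0 : 0 <= N%:R :> R by rewrite ler0n.
  by rewrite /kap -!natr1; field; apply/andP; split; rewrite gt_eqF //; lra.
have kap0 : 0 < kap by rewrite subr_gt0 invf_lt1 // ltr1n.
have kap1 : kap <= 1 by rewrite lerBlDr lerDl.
have Nkj j : (j < N)%N -> (N <= (k j).+1)%N.
  move=> jN; apply: (leq_trans Nk); case: j jN => // j jN.
  by rewrite ltnS ltnW // kk // jN.
have [|||||||s us Hs] := lower_lp (Hw i0) (p := p) (N := N) (a := a)
  (b := V i0) (y := fun j => z (k j)) (t := fun j => iota (mm (k j)) (L (k j)))
  (lo := fun j => mm (k j)) (hi := fun j => mm (k j).+1) (B := fun j => (W (k j))^-1) (k := kap).
- by move=> j _; exact: iota_uniq.
- by move=> j l _; rewrite mem_blk.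
- by move=> j j' /kk h1; exact: mm_sep.
- move=> j l jN; rewrite mem_blk => jl; rewrite /V /vcomb /spread_on Ai0.
  rewrite (bigD1 (Ordinal jN)) //= big1 ?addr0 ?normrM // => j'; rewrite -val_eqE /= => j'j.
  have [->|/nz h2] := eqVneq (z (k j') l) 0; first by rewrite mulr0.
  have /(incr_inj kk) e := mm_inj mm_lt h2 jl.
  by rewrite e ?eqxx ?ltn_ord in j'j.
- by move=> j _; rewrite invr_ge0 ltW.
- by move=> j l _; rewrite mem_blk zpow => ->; rewrite mulr1.
- move=> j jN; apply: le_trans (zsum (k j)); rewrite /kap -lerBrDl opprB addrCA subrr addr0.
  rewrite ler_pdivrMl // -ler_pdivrMr ?invr_gt0 // invrK.
  apply: le_trans (ltW (HW (k j))); rewrite mulrC; apply: (@le_trans _ _ ((k j + 3)%:R * (mm (k j))%:R)).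
    by rewrite ler_wpM2r // ler_nat addn3 !ltnS Nkj.
  by rewrite lerDl.
have sumD : D `^ p <= \sum_(j < N) `|a j| `^ p.
  have Sp0 : 0 <= \sum_(j < N) `|a j| `^ p by apply: sumr_ge0 => j _; exact: powR_ge0.
  have : D <= (\sum_(j < N) `|a j| `^ p) `^ p^-1.
    by apply: HY2; apply: lp_le; rewrite ?powR_ge0 // powRK.
  by move=> /(powR_le_abs p0 D0); rewrite powRK.
have [_ /(_ i0)[_ HV]] := normX_le p1' Hw inV.
apply: (powR_le_inv p0) => //; first by rewrite mulr_ge0 // ltW.
apply: le_trans (HV s us); apply: le_trans Hs; rewrite powRM ?(ltW kap0) //.
apply: (@le_trans _ _ (kap * D `^ p)); last by rewrite ler_pM2l.
by rewrite ler_wpM2r ?powR_ge0 // ge1r_powR // kap0.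
Qed.

End Examples.

(** * The index set of a spreading model *)

Section Classification.
Variables (R : realType) (p : R) (n : nat) (w : nat -> nat -> R).
Hypothesis p1 : 1 < p.
Hypothesis Hw : forall i, weight (w i).
Hypothesis unb : forall i M, exists N, M < wsum (w i) N.
Hypothesis sub : forall i N M, wsum (w i) (N * M) <= wsum (w i) N * wsum (w i) M.

Let p1' : 1 <= p. Proof. exact: ltW. Qed.

Lemma SPw_upper_lp (Y : normedModType R) (yt : nat -> Y) : in_SPw n w p yt ->
  exists2 K : R, 0 <= K & forall N (a : nat -> R) D,
    lorentz_le (fun=> 1) p (trunc N a) D -> `| \sum_(j < N) a j *: yt j | <= K * D.
Proof.
move=> [z [Hz _ null /(spreading_bounds p1' Hw Hz)[K K0 HK]]].
exists (K * 2); first by rewrite mulr_ge0.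
by move=> N a D; exact: (upper_lp_estimate p1' Hw Hz unb null K0 HK).
Qed.

(** Without domination of l_p no coordinate has flat parts, so the peaks decide. The bound runs over
    the dominated d(w_i,p), among them all coordinates with peaks; the generating sequence thereby
    drops out of the statement. *)
Lemma SPw_not_lp (Y : normedModType R) (yt : nat -> Y) : in_SPw n w p yt ->
  ~ dominates_weight p yt (fun=> 1) ->
  (exists i : 'I_n, dominates_weight p yt (w i)) /\
  exists2 K : R, 0 <= K & forall N (a : nat -> R) D,
    (forall i : 'I_n, dominates_weight p yt (w i) -> lorentz_le (w i) p (trunc N a) D) ->
    `| \sum_(j < N) a j *: yt j | <= K * D.
Proof.
move=> [z [Hz _ null /(spreading_bounds p1' Hw Hz)[K K0 HK]]] nlp.
have nonflat i : ~ has_flat_parts p w z i.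
  by move=> /(flat_lower p1' Hw unb Hz null K0 HK).
have peaks (i : 'I_n) := @peaks_lower _ _ _ _ p1' Hw _ Hz _ _ unb null _ K0 HK i.
split; first by have [i /peaks] := ex_peaks p1' Hw Hz nonflat; exists i.
exists (K * 4) => [|N a D H]; first by rewrite mulr_ge0.
apply: (peaks_upper p1' Hw unb Hz null K0 HK sub nonflat) => i /peaks; exact: H.
Qed.

Lemma dominates_weight_trans (Y1 Y2 : normedModType R) (y1 : nat -> Y1) (y2 : nat -> Y2) v :
  weight v -> dominates y2 y1 -> dominates_weight p y1 v -> dominates_weight p y2 v.
Proof.
move=> Hv [C HC] [C1 C10 H1]; exists (C1 * `|C|) => [|N a]; first exact: mulr_ge0.
apply: (lorentz_leW p1' _ (H1 N a)); rewrite -mulrA ler_wpM2l //.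
by apply: (le_trans (HC N a)); rewrite ler_wpM2r // ler_norm.
Qed.

(** The last element stands for l_p: domination of l_p yields the full set outright, and otherwise
    [i < n] keeps [ord_max] out. *)
Definition SPw_index (Y : normedModType R) (yt : nat -> Y) : {set 'I_n.+1} :=
  if `[< dominates_weight p yt (fun=> 1) >] then finset.setTfor 'I_n.+1
  else finset (fun i : 'I_n.+1 => (i < n)%N && `[< dominates_weight p yt (w i) >]).

Lemma SPw_indexP (Y : normedModType R) (yt : nat -> Y) (i : 'I_n) :
  ~ dominates_weight p yt (fun=> 1) ->
  (widen_ord (leqnSn n) i \in SPw_index yt) = `[< dominates_weight p yt (w i) >].
Proof. by move=> /asboolPn/negbTE h; rewrite /SPw_index h finset.inE /= ltn_ord. Qed.

Lemma SPw_index_max (Y : normedModType R) (yt : nat -> Y) :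
  (ord_max \in SPw_index yt) = `[< dominates_weight p yt (fun=> 1) >].
Proof.
by rewrite /SPw_index; case: ifP => _; rewrite finset.inE //= ltnn.
Qed.

Lemma SPw_index_target (Y : normedModType R) (yt : nat -> Y) : in_SPw n w p yt ->
  SPw_index yt \in target_poset n.
Proof.
move=> H; rewrite finset.inE SPw_index_max.
have [lp|nlp] := pselect (dominates_weight p yt (fun=> 1)).
  have -> : SPw_index yt = finset.setTfor 'I_n.+1 by rewrite /SPw_index asboolT.
  rewrite eqxx orbT andbT; apply/finset.set0Pn; exists ord0; exact: finset.in_setT.
rewrite asboolF //= andbT; apply/finset.set0Pn; have [[i Hi] _] := SPw_not_lp H nlp.
by exists (widen_ord (leqnSn n) i); rewrite SPw_indexP //; exact/asboolP.
Qed.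

(** If the second model dominates l_p, it dominates everything. Otherwise neither does, and the
    first model is bounded by the d(w_i,p)-norms over its own index set, all of which the second
    model dominates. *)
Lemma SPw_index_mono (Y1 Y2 : normedModType R) (y1 : nat -> Y1) (y2 : nat -> Y2) :
  in_SPw n w p y1 -> in_SPw n w p y2 ->
  (dominates y2 y1 <-> SPw_index y1 \subset SPw_index y2).
Proof.
move=> H1 H2; split=> [dom|/fintype.subsetP H].
  have tr v : weight v -> dominates_weight p y1 v -> dominates_weight p y2 v.
    by move=> Hv; exact: dominates_weight_trans.
  apply/fintype.subsetP => i; rewrite /SPw_index.
  case: asboolP => [/(tr _ (weight_const1 R)) h|_].
    by rewrite asboolT.
  case: asboolP => _; first by rewrite finset.in_setT.
  rewrite !finset.inE => /andP[-> /asboolP/(tr _ (Hw i)) h] /=; exact/asboolP.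
have [[C2 C20 lp2]|nlp2] := pselect (dominates_weight p y2 (fun=> 1)).
  have [K K0 HK] := SPw_upper_lp H1; exists (K * C2) => N a.
  by rewrite -mulrA; apply: HK; exact: lp2.
have nlp1 : ~ dominates_weight p y1 (fun=> 1).
  by move=> /asboolP; rewrite -SPw_index_max => /H; rewrite SPw_index_max => /asboolP.
have [_ [K K0 HK]] := SPw_not_lp H1 nlp1.
have [|C HC] := @choice _ _ (fun (i : 'I_n) (C : R) => 0 <= C /\ (dominates_weight p y1 (w i) ->
    forall N a, lorentz_le (w i) p (trunc N a) (C * `| \sum_(j < N) a j *: y2 j |))).
  move=> i; have [d1|nd1] := pselect (dominates_weight p y1 (w i)); last by exists 0; split.
  have : widen_ord (leqnSn n) i \in SPw_index y2.
    by apply: H; rewrite SPw_indexP //; exact/asboolP.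
  by rewrite SPw_indexP // => /asboolP[C C0 hC]; exists C; split.
exists (K * \sum_i C i) => N a; rewrite -mulrA; apply: HK => i di.
have [_ /(_ di N a)] := HC i; apply: lorentz_leW => //; rewrite ler_wpM2r //.
by rewrite (bigD1 i) //= lerDl sumr_ge0 // => j _; have [] := HC j.
Qed.

End Classification.

(** * Separation of the classes by the functions S_i *)

Section Separation.
Variables (R : realType) (p : R) (n : nat) (S : nat -> R -> R).
Hypothesis p1 : 1 < p.
Hypothesis HS : forall i, submultiplicative (S i).
Hypothesis sep : forall (A : seq nat) (j : nat), A != [::] -> j \notin A ->
  forall M : R, exists m : nat,
    (1 <= m)%N /\ M < S j m%:R / \big[Num.max/0]_(i <- A) S i m%:R.

Let w i := weight_of (S i).
Let Hw i : weight (w i). Proof. exact: weight_of_weight. Qed.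
Let p0 : 0 < p. Proof. exact: lt_trans p1. Qed.

Lemma wsum_S i m : (0 < m)%N -> wsum (w i) m = S i m%:R.
Proof. by case: m => // m _; exact: wsum_weight_of. Qed.

Lemma S_ge1 i m : (0 < m)%N -> 1 <= S i m%:R.
Proof.
move=> m0; rewrite -wsum_S // -[leLHS](weight0 (Hw i)) -[leLHS]add0r -(wsum0 (w i)) -wsumS.
exact: wsum_le.
Qed.

(** Separation from the single index [i.+1] makes [S i] exceed large multiples of [S i.+1], which is
    at least 1. *)
Lemma wsum_unbounded i (M : R) : exists N, M < wsum (w i) N.
Proof.
have [|m [m1 Hm]] := sep (A := [:: i.+1]) (j := i) isT _ `|M|.
  by rewrite inE neq_ltn ltnSn.
exists m; rewrite wsum_S //; apply: (le_lt_trans (ler_norm M)); apply: lt_le_trans Hm _.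
have S1 := S_ge1 i.+1 m1; have S0 : 0 <= S i m%:R by apply: le_trans (S_ge1 i m1).
rewrite big_cons big_nil (max_l (le_trans ler01 S1)) ler_pdivrMr; last exact: lt_le_trans S1.
by rewrite ler_peMr.
Qed.

(** Tested on [m] ones: the model norm is at most the p-th root of the maximum of [S i m] over [A],
    while the gauge for [v] is at least that of [S j m]. Comparing [S j] with [wsum v] by an
    inequality covers both [v = w j] and l_p. *)
Lemma model_not_dominates (A : {set 'I_n}) (i0 : 'I_n) (Y : normedModType R) (yt : nat -> Y) v j :
  i0 \in A -> weight v -> (forall i, i \in A -> val i != j) ->
  (forall m, (0 < m)%N -> S j m%:R <= wsum v m) ->
  (forall N (a : nat -> R) D, 0 <= D -> (forall i, i \in A -> lorentz_le (w i) p (trunc N a) D) ->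
     `| \sum_(j < N) a j *: yt j | <= D) ->
  ~ dominates_weight p yt v.
Proof.
move=> Ai0 Hv jA Hj HY [C C0 HC].
pose s := [seq val i | i <- enum A].
have ms (i : 'I_n) : i \in A -> val i \in s by move=> iA; rewrite map_f // mem_enum.
have s0 : s != [::] by apply/eqP => s0; have := ms i0 Ai0; rewrite s0.
have js : j \notin s.
  by apply/mapP => -[i]; rewrite mem_enum => /jA/eqP ij /esym.
have [m [m1]] := sep s0 js (C `^ p).
set X := \big[Num.max/0]_(i <- s) _.
have leX (i : 'I_n) : i \in A -> S i m%:R <= X.
  by move=> iA; exact: (le_bigmax_seq 0 (val i) xpredT (fun i => S i m%:R) (ms i iA) isT).
have X0 : 0 < X by apply: lt_le_trans (leX i0 Ai0); apply: lt_le_trans (S_ge1 i0 m1).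
rewrite ltr_pdivlMr // ltNge => /negP; apply.
have D0 : 0 <= X `^ p^-1 by exact: powR_ge0.
have hD : `| \sum_(j < m) (1 : R) *: yt j | <= X `^ p^-1.
  apply: (HY m (fun=> 1)) => // i iA; split=> // t ut; rewrite powRK ?(ltW X0) //.
  apply: le_trans (leX i iA); rewrite -wsum_S //.
  rewrite (eq_rsum (Hw i) (c' := fun l => (l < m)%N%:R)).
    apply: (le_trans (rsum_indic (Hw i) (P := fun l => (l < m)%N) (e := iota 0 m) ut _)).
      by move=> l _; rewrite mem_iota.
    by rewrite size_iota.
  move=> l _; rewrite /abspow /trunc; case: ifP => _; first by rewrite normr1 powR1.
  by rewrite normr0 powR0 // gt_eqF.
apply: (le_trans (Hj m m1)).
have [_ /(_ (iota 0 m) (iota_uniq _ _))] := HC m (fun=> 1).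
have := rsum_ge_level (ltW p1) Hv (a := trunc m (fun=> 1)) ler01 (e := iota 0 m).
rewrite size_iota powR1 mul1r => /(_ _)/le_trans h /h.
move=> /(_ _)/le_trans; apply.
  by move=> l; rewrite mem_iota /trunc add0n => /andP[_ ->]; rewrite normr1.
have -> : C `^ p * X = (C * X `^ p^-1) `^ p by rewrite powRM // powRK // ltW.
by apply: powR_le_abs => //; [exact: mulr_ge0|rewrite ler_wpM2l].
Qed.

Lemma SPw_index_surj (B : {set 'I_n.+1}) : (0 < n)%N -> B \in target_poset n ->
  exists (Y : normedModType R) (yt : nat -> Y),
    in_SPw n w p yt /\ SPw_index p n w yt = B.
Proof.
move=> n0; rewrite finset.inE => /andP[/finset.set0Pn[b Bb] HB].
have [Bmax|Bmax] := boolP (ord_max \in B).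
  move: HB; rewrite Bmax /= => /eqP->.
  have [Y [yt [H1 H2]]] := flat_block_model p1 Hw (@wsum_unbounded (Ordinal n0)).
  by exists Y, yt; split=> //; rewrite /SPw_index asboolT.
pose A : {set 'I_n} := finset (fun i : 'I_n => widen_ord (leqnSn n) i \in B).
have bn : (b < n)%N.
  rewrite ltn_neqAle -ltnS ltn_ord andbT; apply: contraNneq Bmax => bn.
  by rewrite (_ : ord_max = b) //; apply/val_inj.
have Ab : Ordinal bn \in A.
  by rewrite finset.inE (_ : widen_ord _ _ = b) //; apply/val_inj.
have [Y [yt [H1 HY]]] := unit_vector_model p1 Hw Ab; exists Y, yt; split=> //.
have HY2 N a D := (HY N a).2 D.
have nlp : ~ dominates_weight p yt (fun=> 1).
  (* For l_p the fresh index [n], outside all coordinates, is used: [S n m] is at most [m]. *)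
  apply: (model_not_dominates (j := n) Ab (weight_const1 R)) HY2.
    by move=> i _; rewrite neq_ltn ltn_ord.
  move=> m m0; rewrite -wsum_S //; apply: (le_trans (wsum_le_nat (Hw n) m)).
  by rewrite /wsum sumr_const card_ord.
apply/finset.setP => i; have [im|im] := eqVneq i ord_max.
  by rewrite im SPw_index_max (negbTE Bmax) asboolF.
have i_n : (i < n)%N by rewrite ltn_neqAle -ltnS ltn_ord andbT; move: im; rewrite -val_eqE.
have -> : i = widen_ord (leqnSn n) (Ordinal i_n) by apply/val_inj.
rewrite SPw_indexP //; have [iB|iB] := boolP (widen_ord _ _ \in B).
  apply/asboolP; exists 1 => // N a; rewrite mul1r.
  by apply: (HY N a).1 (Ordinal i_n) _; rewrite finset.inE.
apply/asboolPn; apply: (model_not_dominates (j := i) Ab (Hw i)) HY2.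
  move=> i'; rewrite finset.inE => i'B; apply: contraNneq iB => e.
  by rewrite (_ : widen_ord _ _ = widen_ord (leqnSn n) i') //; apply/val_inj => /=; rewrite e.
by move=> m m0; rewrite -wsum_S.
Qed.

End Separation.

(* S i is the paper's S_(i+1); weight_of (S i) k is the paper's w_(i+1)(k+1).
   X_n(p) is represented through in_X / normX with weights (fun i => weight_of (S i)). *)
Theorem theorem2p10 (R : realType) (p : R) (S : nat -> R -> R) (n : nat) :
  1 < p ->
  (forall i : nat, submultiplicative (S i)) ->
  (forall (A : seq nat) (j : nat), A != [::] -> j \notin A ->
     forall M : R, exists m : nat,
       (1 <= m)%N /\ M < S j m%:R / \big[Num.max/0]_(i <- A) S i m%:R) ->
  (forall i : nat, weight_of (S i) @ \oo --> (0 : R)) ->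
  (1 <= n)%N ->
  exists Phi : forall Y : normedModType R, (nat -> Y) -> {set 'I_n.+1},
    [/\ (forall (Y : normedModType R) (xt : nat -> Y),
           @in_SPw R n (fun i => weight_of (S i)) p Y xt -> Phi Y xt \in target_poset n),
        (forall (Y1 Y2 : normedModType R) (xt1 : nat -> Y1) (xt2 : nat -> Y2),
           @in_SPw R n (fun i => weight_of (S i)) p Y1 xt1 ->
           @in_SPw R n (fun i => weight_of (S i)) p Y2 xt2 ->
           (dominates xt2 xt1 <-> Phi Y1 xt1 \subset Phi Y2 xt2)) &
        (forall B : {set 'I_n.+1}, B \in target_poset n ->
           exists (Y : normedModType R) (xt : nat -> Y),
             @in_SPw R n (fun i => weight_of (S i)) p Y xt /\ Phi Y xt = B)].
Proof.
move=> p1 HS sep _ n0; pose w i := weight_of (S i).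
have Hw i : weight (w i) by exact: weight_of_weight.
have unb i M : exists N, M < wsum (w i) N := wsum_unbounded HS sep i M.
have sub i N M := wsum_weight_of_mul (HS i) N M.
exists (fun Y yt => SPw_index p n w yt); split.
- by move=> Y yt; exact: (SPw_index_target p1 Hw unb sub).
- by move=> Y1 Y2 y1 y2; exact: (SPw_index_mono p1 Hw unb sub).
- by move=> B; exact: (SPw_index_surj p1 HS sep n0).
Qed.
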